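(* Let $X$ be a set with $|X| = 2$. There exists a Hall set $\mathcal{B} \subset \mathrm{Br}(X)$ such that, for every $a < b \in \mathcal{B}$ with $n := |a|+|b| \geq 3$, $$\| [a, b] \|_{\mathcal{B}} \leq F_{n-2},$$ where $(F_\nu)_{\nu\in\mathbb{N}}$ denotes the Fibonacci numbers ($F_0=0$, $F_1=1$, $F_{\nu+2}=F_{\nu+1}+F_\nu$).
   Context: The base field is $\mathbb{K}=\mathbb{R}$ or $\mathbb{C}$. $\mathrm{Br}(X)$ is the free magma over $X$: the set of formal binary brackets (rooted planar binary trees with leaves labelled by elements of $X$), with product $(t_1,t_2)$. For $t\in \mathrm{Br}(X)$, $|t|$ is its number of leaves; if $t\notin X$, $t$ is written uniquely as $t=(\lambda(t),\mu(t))$. $\mathcal{L}(X)$ is the free Lie algebra over $X$ and $\mathrm{ev}:\mathrm{Br}(X)\to\mathcal{L}(X)$ is the canonical evaluation ($\mathrm{ev}(x)=x$ for $x\in X$, $\mathrm{ev}((t_1,t_2))=[\mathrm{ev}(t_1),\mathrm{ev}(t_2)]$). For $a,b\in\mathrm{Br}(X)$, $[a,b]$ denotes $[\mathrm{ev}(a),\mathrm{ev}(b)]\in\mathcal{L}(X)$. A Hall set is a subset $\mathcal{B}\subset\mathrm{Br}(X)$ endowed with a total order $<$ such that: (i) $X\subset\mathcal{B}$; (ii) for all $b_1,b_2\in\mathrm{Br}(X)$, $(b_1,b_2)\in\mathcal{B}$ iff $b_1,b_2\in\mathcal{B}$, $b_1<b_2$ and either $b_2\in X$ or $\lambda(b_2)\leq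 b_1$; (iii) for all $b_1,b_2\in\mathcal{B}$ with $(b_1,b_2)\in\mathcal{B}$, $b_1<(b_1,b_2)$. By a theorem of Viennot, $\mathrm{ev}$ is injective on $\mathcal{B}$ and $\mathrm{ev}(\mathcal{B})$ is a basis of $\mathcal{L}(X)$. For $u=\sum_{c\in\mathcal{B}}\alpha_c\,\mathrm{ev}(c)\in\mathcal{L}(X)$ (finite sum), $\|u\|_{\mathcal{B}}:=\sum_{c}|\alpha_c|$. *)

(* Defs.v *)
From HB Require Import structures.
From mathcomp Require Import all_boot all_order all_algebra.
From mathcomp Require Import finmap boolp classical_sets reals constructive_ereal.
From mathcomp Require Import complex.

Set Implicit Arguments.
Unset Strict Implicit.
Unset Printing Implicit Defensive.

Import Order.TTheory GRing.Theory Num.Theory.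
Local Open Scope ring_scope.
Local Open Scope quotient_scope.

Variant real_or_complex (R : realType) : numFieldType -> Prop :=
| Base_real : real_or_complex R R
| Base_complex : real_or_complex R R[i].

Fixpoint fib (n : nat) : nat :=
  match n with
  | 0 => 0
  | 1 => 1
  | (m.+1 as p).+1 => fib p + fib m
  end%N.

Inductive br (X : Type) : Type :=
| Leaf of X
| Node of br X & br X.

Fixpoint br_size (X : Type) (t : br X) : nat :=
  match t with
  | Leaf _ => 1
  | Node t1 t2 => br_size t1 + br_size t2
  end%N.

Section BrChoice.
Variable X : choiceType.

Fixpoint br_encode (t : br X) : GenTree.tree X :=
  match t with
  | Leaf x => GenTree.Leaf x
  | Node t1 t2 => GenTree.Node 0 [:: br_encode t1; br_encode t2]
  end.

Fixpoint br_decode (t : GenTree.tree X) : option (br X) :=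
  match t with
  | GenTree.Leaf x => Some (Leaf x)
  | GenTree.Node 0 [:: t1; t2] =>
    match br_decode t1, br_decode t2 with
    | Some u1, Some u2 => Some (Node u1 u2)
    | _, _ => None
    end
  | _ => None
  end.

Lemma br_encodeK : pcancel br_encode br_decode.
Proof. by elim=> //= t1 -> t2 ->. Qed.

HB.instance Definition _ := Choice.copy (br X) (pcan_type br_encodeK).

End BrChoice.

HB.mixin Record Lmodule_isLie (K : fieldType) V of GRing.Lmodule K V := {
  lie : V -> V -> V ;
  lieDl : forall u v w, lie (u + v) w = lie u w + lie v w ;
  lieZl : forall (a : K) u v, lie (a *: u) v = a *: lie u v ;
  lieDr : forall u v w, lie u (v + w) = lie u v + lie u w ;
  lieZr : forall (a : K) u v, lie u (a *: v) = a *: lie u v ;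
  liexx : forall u, lie u u = 0 ;
  lie_jacobi : forall u v w,
    lie u (lie v w) + lie v (lie w u) + lie w (lie u v) = 0
}.

#[short(type="lieAlgType")]
HB.structure Definition LieAlgebra (K : fieldType) :=
  {V of GRing.Lmodule K V & Lmodule_isLie K V}.

(* The free Lie algebra over X is presented by generators and relations: formal
   Lie expressions modulo the congruence generated by the Lie algebra axioms.
   lie_lift and lie_lift_unique below give its universal property. *)
Inductive lie_term (K X : Type) : Type :=
| LVar of X
| LZero
| LAdd of lie_term K X & lie_term K X
| LScale of K & lie_term K X
| LBracket of lie_term K X & lie_term K X.
Arguments LVar {K X}.
Arguments LZero {K X}.

HB.instance Definition _ (K X : Type) := gen_eqMixin (lie_term K X).
HB.instance Definition _ (K X : Type) := gen_choiceMixin (lie_term K X).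

Inductive lie_cong (K : fieldType) (X : Type) :
  lie_term K X -> lie_term K X -> Prop :=
| lc_refl t : lie_cong t t
| lc_sym t u : lie_cong t u -> lie_cong u t
| lc_trans t u v : lie_cong t u -> lie_cong u v -> lie_cong t v
| lc_add t t' u u' : lie_cong t t' -> lie_cong u u' ->
    lie_cong (LAdd t u) (LAdd t' u')
| lc_scale a t t' : lie_cong t t' -> lie_cong (LScale a t) (LScale a t')
| lc_bracket t t' u u' : lie_cong t t' -> lie_cong u u' ->
    lie_cong (LBracket t u) (LBracket t' u')
| lc_addA t u v : lie_cong (LAdd t (LAdd u v)) (LAdd (LAdd t u) v)
| lc_addC t u : lie_cong (LAdd t u) (LAdd u t)
| lc_add0 t : lie_cong (LAdd LZero t) t
| lc_addN t : lie_cong (LAdd (LScale (-1) t) t) LZero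
| lc_scaleA a b t : lie_cong (LScale a (LScale b t)) (LScale (a * b) t)
| lc_scale1 t : lie_cong (LScale 1 t) t
| lc_scaleDr a t u :
    lie_cong (LScale a (LAdd t u)) (LAdd (LScale a t) (LScale a u))
| lc_scaleDl a b t :
    lie_cong (LScale (a + b) t) (LAdd (LScale a t) (LScale b t))
| lc_lieDl t u v :
    lie_cong (LBracket (LAdd t u) v) (LAdd (LBracket t v) (LBracket u v))
| lc_lieZl a t u : lie_cong (LBracket (LScale a t) u) (LScale a (LBracket t u))
| lc_lieDr t u v :
    lie_cong (LBracket t (LAdd u v)) (LAdd (LBracket t u) (LBracket t v))
| lc_lieZr a t u : lie_cong (LBracket t (LScale a u)) (LScale a (LBracket t u))
| lc_liexx t : lie_cong (LBracket t t) LZero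
| lc_jacobi t u v :
    lie_cong (LAdd (LAdd (LBracket t (LBracket u v)) (LBracket u (LBracket v t)))
                   (LBracket v (LBracket t u))) LZero.

Section FreeLie.
Variables (K : fieldType) (X : Type).
Implicit Types (t u v : lie_term K X) (a b : K).

Definition lie_congb t u : bool := `[< lie_cong t u >].

Lemma lie_congb_refl : reflexive lie_congb.
Proof. by move=> t; apply/asboolP; exact: lc_refl. Qed.

Lemma lie_congb_sym : symmetric lie_congb.
Proof. by move=> t u; apply/asboolP/asboolP; exact: lc_sym. Qed.

Lemma lie_congb_trans : transitive lie_congb.
Proof.
by move=> u t v /asboolP tu /asboolP uv; apply/asboolP; exact: lc_trans tu uv.
Qed.

Canonical lie_equiv :=
  EquivRel lie_congb lie_congb_refl lie_congb_sym lie_congb_trans.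

Definition free_lie := {eq_quot lie_equiv}.

HB.instance Definition _ := Choice.on free_lie.
HB.instance Definition _ := EqQuotient.on free_lie.

Definition flie (t : lie_term K X) : free_lie := \pi_free_lie t.

Lemma flieP t u : lie_cong t u <-> flie t = flie u.
Proof.
split=> [tu|/eqmodP/asboolP //]; apply/eqmodP.
exact/asboolP.
Qed.

Lemma flie_repr (x : free_lie) : flie (repr x) = x.
Proof. exact: reprK. Qed.

Lemma repr_flie t : lie_cong (repr (flie t)) t.
Proof. by apply/flieP; rewrite flie_repr. Qed.

Definition flie_add (x y : free_lie) := flie (LAdd (repr x) (repr y)).
Definition flie_opp (x : free_lie) := flie (LScale (-1) (repr x)).
Definition flie_scale a (x : free_lie) := flie (LScale a (repr x)).
Definition flie_lie (x y : free_lie) := flie (LBracket (repr x) (repr y)).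

Lemma flie_addE t u : flie_add (flie t) (flie u) = flie (LAdd t u).
Proof. by apply/flieP; apply: lc_add; exact: repr_flie. Qed.

Lemma flie_oppE t : flie_opp (flie t) = flie (LScale (-1) t).
Proof. by apply/flieP; apply: lc_scale; exact: repr_flie. Qed.

Lemma flie_scaleE a t : flie_scale a (flie t) = flie (LScale a t).
Proof. by apply/flieP; apply: lc_scale; exact: repr_flie. Qed.

Lemma flie_lieE t u : flie_lie (flie t) (flie u) = flie (LBracket t u).
Proof. by apply/flieP; apply: lc_bracket; exact: repr_flie. Qed.

Let flieE := (flie_addE, flie_oppE, flie_scaleE, flie_lieE).

Lemma flie_ind (P : free_lie -> Prop) : (forall t, P (flie t)) -> forall x, P x.
Proof. by move=> Pt x; rewrite -(flie_repr x). Qed.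

Fact flie_addA : associative flie_add.
Proof.
elim/flie_ind=> t; elim/flie_ind=> u; elim/flie_ind=> v.
by rewrite !flieE; apply/flieP; exact: lc_addA.
Qed.

Fact flie_addC : commutative flie_add.
Proof.
elim/flie_ind=> t; elim/flie_ind=> u.
by rewrite !flieE; apply/flieP; exact: lc_addC.
Qed.

Fact flie_add0 : left_id (flie LZero) flie_add.
Proof. by elim/flie_ind=> t; rewrite !flieE; apply/flieP; exact: lc_add0. Qed.

Fact flie_addN : left_inverse (flie LZero) flie_opp flie_add.
Proof. by elim/flie_ind=> t; rewrite !flieE; apply/flieP; exact: lc_addN. Qed.

HB.instance Definition _ := GRing.isZmodule.Build free_lie
  flie_addA flie_addC flie_add0 flie_addN.

Fact flie_scaleA a b (x : free_lie) :
  flie_scale a (flie_scale b x) = flie_scale (a * b) x.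
Proof. by elim/flie_ind: x => t; rewrite !flieE; apply/flieP; exact: lc_scaleA. Qed.

Fact flie_scale1 : left_id 1 flie_scale.
Proof. by elim/flie_ind=> t; rewrite !flieE; apply/flieP; exact: lc_scale1. Qed.

Fact flie_scaleDr : right_distributive flie_scale +%R.
Proof.
move=> a; elim/flie_ind=> t; elim/flie_ind=> u.
by rewrite /GRing.add /= !flieE; apply/flieP; exact: lc_scaleDr.
Qed.

Fact flie_scaleDl (x : free_lie) :
  {morph flie_scale^~ x : a b / a + b}.
Proof.
move=> a b; elim/flie_ind: x => t.
by rewrite [in RHS]/GRing.add /= !flieE; apply/flieP; exact: lc_scaleDl.
Qed.

HB.instance Definition _ := GRing.Zmodule_isLmodule.Build K free_lie
  flie_scaleA flie_scale1 flie_scaleDr flie_scaleDl.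

Lemma flieD t u : flie (LAdd t u) = flie t + flie u.
Proof. by rewrite -flie_addE. Qed.

Lemma flieZ a t : flie (LScale a t) = a *: flie t.
Proof. by rewrite -flie_scaleE. Qed.

Lemma flie0 : flie LZero = 0. Proof. by []. Qed.

Fact flie_lieDl x y z : flie_lie (x + y) z = flie_lie x z + flie_lie y z.
Proof.
elim/flie_ind: x => t; elim/flie_ind: y => u; elim/flie_ind: z => v.
by rewrite -flieD !flie_lieE -flieD; apply/flieP; exact: lc_lieDl.
Qed.

Fact flie_lieZl a x y : flie_lie (a *: x) y = a *: flie_lie x y.
Proof.
elim/flie_ind: x => t; elim/flie_ind: y => u.
by rewrite -flieZ !flie_lieE -flieZ; apply/flieP; exact: lc_lieZl.
Qed.

Fact flie_lieDr x y z : flie_lie x (y + z) = flie_lie x y + flie_lie x z.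
Proof.
elim/flie_ind: x => t; elim/flie_ind: y => u; elim/flie_ind: z => v.
by rewrite -flieD !flie_lieE -flieD; apply/flieP; exact: lc_lieDr.
Qed.

Fact flie_lieZr a x y : flie_lie x (a *: y) = a *: flie_lie x y.
Proof.
elim/flie_ind: x => t; elim/flie_ind: y => u.
by rewrite -flieZ !flie_lieE -flieZ; apply/flieP; exact: lc_lieZr.
Qed.

Fact flie_liexx x : flie_lie x x = 0.
Proof. by elim/flie_ind: x => t; rewrite flie_lieE; apply/flieP; exact: lc_liexx. Qed.

Fact flie_jacobi x y z :
  flie_lie x (flie_lie y z) + flie_lie y (flie_lie z x)
    + flie_lie z (flie_lie x y) = 0.
Proof.
elim/flie_ind: x => t; elim/flie_ind: y => u; elim/flie_ind: z => v.
by rewrite !flie_lieE -!flieD; apply/flieP; exact: lc_jacobi.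
Qed.

HB.instance Definition _ := Lmodule_isLie.Build K free_lie
  flie_lieDl flie_lieZl flie_lieDr flie_lieZr flie_liexx flie_jacobi.

Lemma flieL t u : flie (LBracket t u) = lie (flie t) (flie u).
Proof. by rewrite -flie_lieE. Qed.

Definition lie_gen (x : X) : free_lie := flie (LVar x).

Fixpoint ev (t : br X) : free_lie :=
  match t with
  | Leaf x => lie_gen x
  | Node t1 t2 => lie (ev t1) (ev t2)
  end.

End FreeLie.

Section UniversalProperty.
Variables (K : fieldType) (X : Type) (V : lieAlgType K) (g : X -> V).

Fixpoint lie_eval (t : lie_term K X) : V :=
  match t with
  | LVar x => g x
  | LZero => 0
  | LAdd t u => lie_eval t + lie_eval u
  | LScale a t => a *: lie_eval t
  | LBracket t u => lie (lie_eval t) (lie_eval u)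
  end.

Lemma lie_eval_cong t u : lie_cong t u -> lie_eval t = lie_eval u.
Proof.
elim=> //=.
- by move=> ? ? ? _ -> _ ->.
- by move=> ? ? ? ? _ -> _ ->.
- by move=> ? ? ? _ ->.
- by move=> ? ? ? ? _ -> _ ->.
- by move=> *; rewrite addrA.
- by move=> *; rewrite addrC.
- by move=> *; rewrite add0r.
- by move=> *; rewrite scaleN1r addNr.
- by move=> *; rewrite scalerA.
- by move=> *; rewrite scale1r.
- by move=> *; rewrite scalerDr.
- by move=> *; rewrite scalerDl.
- by move=> *; rewrite lieDl.
- by move=> *; rewrite lieZl.
- by move=> *; rewrite lieDr.
- by move=> *; rewrite lieZr.
- by move=> *; rewrite liexx.
- by move=> *; rewrite lie_jacobi.
Qed.

Definition lie_lift (x : free_lie K X) : V := lie_eval (repr x).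

Lemma lie_liftE t : lie_lift (flie t) = lie_eval t.
Proof. by apply: lie_eval_cong; exact: repr_flie. Qed.

Lemma lie_lift_gen x : lie_lift (lie_gen K x) = g x.
Proof. exact: lie_liftE. Qed.

Fact lie_lift_linear : linear lie_lift.
Proof.
move=> a; elim/flie_ind=> t; elim/flie_ind=> u.
by rewrite -flieZ -flieD !lie_liftE.
Qed.

HB.instance Definition _ :=
  GRing.isLinear.Build K (free_lie K X) V *:%R lie_lift lie_lift_linear.

Lemma lie_lift_lie : {morph lie_lift : x y / lie x y}.
Proof.
by elim/flie_ind=> t; elim/flie_ind=> u; rewrite -flieL !lie_liftE.
Qed.

Lemma lie_lift_unique (f : {linear free_lie K X -> V}) :
  {morph f : x y / lie x y} -> (forall x, f (lie_gen K x) = g x) ->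
  f =1 lie_lift.
Proof.
move=> fL fg; elim/flie_ind=> t; rewrite lie_liftE.
elim: t => [x||t IHt u IHu|a t IHt|t IHt u IHu] /=.
- exact: fg.
- by rewrite flie0 linear0.
- by rewrite flieD linearD IHt IHu.
- by rewrite flieZ linearZ IHt.
- by rewrite flieL fL IHt IHu.
Qed.

End UniversalProperty.

(* Only the values of lt on B matter. *)
Record hall_set (X : Type) (B : set (br X)) (lt : br X -> br X -> Prop) : Prop :=
{ hall_irr : forall a, B a -> ~ lt a a ;
  hall_trans : forall a b c, B a -> B b -> B c -> lt a b -> lt b c -> lt a c ;
  hall_total : forall a b, B a -> B b -> [\/ lt a b, a = b | lt b a] ;
  hall_leaf : forall x, B (Leaf x) ;
  hall_node : forall b1 b2, B (Node b1 b2) <->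
    [/\ B b1, B b2, lt b1 b2 &
      (exists x, b2 = Leaf x)
      \/ (exists l r, b2 = Node l r /\ (l = b1 \/ lt l b1))] ;
  hall_lt_node : forall b1 b2, B b1 -> B b2 -> B (Node b1 b2) ->
    lt b1 (Node b1 b2)
}.

Section HallNorm.
Variables (K : numFieldType) (X : choiceType) (B : set (br X)).

Definition hall_expansion (u : free_lie K X) (alpha : {fsfun br X -> K with 0}) :=
  (forall c, c \in finsupp alpha -> B c)
  /\ u = \sum_(c <- finsupp alpha) alpha c *: ev K c.

(* The value +oo is a junk value: by Viennot's theorem, when B is a Hall set
   every u has exactly one expansion. *)
Definition hall_norm (u : free_lie K X) : \bar K :=
  if pselect (exists! alpha, hall_expansion u alpha) is left uniq_alpha
  then (\sum_(c <- finsupp (sval (cid uniq_alpha))) `|sval (cid uniq_alpha) c|)%:E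
  else +oo%E.

End HallNorm.

(* Main.v *)
Require Import Defs.
From HB Require Import structures.
From mathcomp Require Import all_boot all_order all_algebra.
From mathcomp Require Import finmap boolp classical_sets reals constructive_ereal.
From mathcomp Require Import zify.

(* Write X = {x0, x1} and order trees so that x0 is minimal, x1 is maximal, and
   trees that are not letters are compared lexicographically, first by their
   left factor lambda, then by their right factor mu. The Hall set B of this
   order has the minimal growth.

   For a < b = (p, b') in B with a < p (otherwise (a, b) is in B), the Jacobi
   identity gives [a, b] = [[a, p], b'] + [p, [a, b']]. The lexicographic order
   controls which e in B occur in [a, b] (the predicate supp): the only brackets
   [p, e] with p < e that leave B split into two elements of B. Measuring a by
   the length lvl(a) of its chain a, lambda(a), lambda(lambda(a)), ..., an
   induction on |b| then yields ||[a, b]|| <= F(|b| + 1 - lvl a) when a is not a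
   letter. For a = x0 this has to be improved to F(|b| - 1), simultaneously with
   ||[G_r, b]|| <= F(|b| - r - 1) for G_r = (...((x0, x1), x1) ..., x1); the
   elements b = (y1, b') with y1 = (x0, x1) need a separate count, where the
   number of terms that can still split is tracked.

   That a Hall set is free in the free Lie algebra, hence that norms are well
   defined, is proved by Lazard elimination: eliminating the least element b of
   an alphabet embeds the situation in the semidirect product of a free Lie
   algebra by a derivation that sends each letter t to the letter (b, t). *)

Set Implicit Arguments.
Unset Strict Implicit.
Unset Printing Implicit Defensive.

Import Order.TTheory GRing.Theory Num.Theory.

Local Notation x0 := (Leaf false).
Local Notation x1 := (Leaf true).

(** * The lexicographic order on trees, its Hall set, and the level of a tree *)

Section LexicographicOrder.
Local Open Scope order_scope.

Implicit Types a b c e s t : br bool.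

Fixpoint lt_br a b : bool :=
  match a, b with
  | Leaf x, Leaf y => ~~ x && y
  | Leaf x, Node _ _ => ~~ x
  | Node _ _, Leaf y => y
  | Node a1 a2, Node b1 b2 => lt_br a1 b1 || (a1 == b1) && lt_br a2 b2
  end.

Fact lt_br_irr : irreflexive lt_br.
Proof. by elim=> [[]|a IHa b IHb] //=; rewrite IHa IHb eqxx. Qed.

Fact lt_br_trans : transitive lt_br.
Proof.
move=> b a c; elim: a b c => [[]|a1 IH1 a2 IH2] [[]|b1 b2] [[]|c1 c2] //=.
case/orP=> [lt1|/andP[/eqP-> lt2]] /orP[lt1'|/andP[/eqP<- lt2']].
- by rewrite (IH1 b1).
- by rewrite lt1.
- by rewrite lt1'.
- by rewrite eqxx (IH2 b2) ?orbT.
Qed.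

Fact lt_br_total a b : a != b -> lt_br a b || lt_br b a.
Proof.
elim: a b => [[]|a1 IH1 a2 IH2] [[]|b1 b2] //=.
have [->|/IH1/orP[->|->]//] := eqVneq a1 b1; last by rewrite orbT.
have [->|/IH2/orP[->|->]] := eqVneq a2 b2; rewrite ?lt_br_irr ?eqxx ?orbT //.
Qed.

Fact br_display : Order.disp_t. Proof. exact: Order.Disp tt tt. Qed.

HB.instance Definition _ := Order.LtOrder.Build br_display (br bool)
  (fun _ _ => erefl) (fun _ _ => erefl) (fun _ _ => erefl)
  lt_br_irr lt_br_trans lt_br_total.

Lemma ltNN a1 a2 b1 b2 :
  (Node a1 a2 < Node b1 b2) = (a1 < b1) || (a1 == b1) && (a2 < b2).
Proof. by []. Qed.

Lemma lt_x1 a : (a < x1) = (a != x1).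
Proof. by case: a => [[]|]. Qed.

Lemma x1_gtF a : (x1 < a) = false.
Proof. by case: a => [[]|]. Qed.

Lemma lt_x0F a : (a < x0) = false.
Proof. by case: a => [[]|]. Qed.

Lemma le_x0 a : x0 <= a.
Proof. by rewrite leNgt lt_x0F. Qed.

Definition left_le b a := if b is Node l _ then l <= a else true.

Fixpoint hall t := if t is Node a b then
  [&& hall a, hall b, a < b & left_le b a] else true.

Lemma lt_left a b : hall (Node a b) -> a < Node a b.
Proof.
elim: a b => [[]|a1 IH1 a2 IH2] b //.
  by case/and4P; rewrite x1_gtF.
case/and4P => ha _ _ _; rewrite ltNN IH1 //.
Qed.

Lemma left_lt_trans a b c : left_le b a -> a <= c -> left_le b c.
Proof. by case: b => //= l r; exact: le_trans. Qed.

Fixpoint lvl t : nat := if t is Node l _ then (lvl l).+1 else 0.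

(** Non-letters are compared through their left factors first, so [a <= b] descends along both left
    chains. The maximal letter [x1] has level 0 and must be excluded; a left factor in the Hall set
    is never [x1]. *)
Lemma lvl_le a b : hall b -> b != x1 -> a <= b -> (lvl a <= lvl b)%N.
Proof.
elim: a b => [//|a1 IH1 a2 IH2] [[]//|b1 b2] /=.
case/and4P => hb1 _ b12 _ _ le_ab; rewrite ltnS; apply: IH1 => //.
  by apply: contraTneq b12 => ->; rewrite x1_gtF.
by move: le_ab; rewrite leNgt ltNN negb_or => /andP[]; rewrite -leNgt.
Qed.

Lemma br_size_gt0 (X : Type) (t : br X) : (0 < br_size t)%N.
Proof. by elim: t => //= a IHa b IHb; lia. Qed.

Lemma lvl_lt_size t : (lvl t < br_size t)%N.
Proof. by elim: t => //= a IHa b _; have := br_size_gt0 b; lia. Qed.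

End LexicographicOrder.

(** * Which trees can occur in a bracket *)

Section Support.
Local Open Scope order_scope.
Implicit Types a b c e t : br bool.

(* [grows p t]: lambda(t) <= p and t < (p, t), with lambda(t) = p analysed
   through mu(t) < t. *)
Definition grows p t :=
  if t is Node l r then (l < p) || (l == p) && (r < t) else false.

(* For a < p = lambda(b), every e occurring in [a, b] satisfies [near p e], and
   this is what makes [p, e] a sum of at most two elements of the Hall set. *)
Definition near p e :=
  if e is Node e1 e2 then (e1 <= p) || grows p e1 && left_le e2 p else false.

(** An upper bound for the trees occurring in [a, b], shaped to be stable under the Leibniz step:
    left factors lie in [a, b), a bracket already in the Hall set contributes only itself, and
    otherwise terms are near lambda(b). *)
Definition supp a b e :=
  [&& hall e, (if e is Node e1 _ then a <= e1 < b else false),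
      left_le b a ==> (e == Node a b) &
      (if b is Node p _ then (a < p) ==> near p e else true)].

Lemma grows_le p q t : p <= q -> grows p t -> grows q t.
Proof.
case: t => //= l r le_pq /orP[lt_lp|/andP[/eqP-> lt_r]].
  by rewrite (lt_le_trans lt_lp le_pq).
by move: le_pq; rewrite le_eqVlt => /orP[/eqP<-|->//]; rewrite eqxx lt_r orbT.
Qed.

Lemma near_le p q e : p <= q -> near p e -> near q e.
Proof.
case: e => //= e1 e2 le_pq /orP[le_e1|/andP[gr le_e2]].
  by rewrite (le_trans le_e1 le_pq).
by rewrite (grows_le le_pq gr) (left_lt_trans le_e2 le_pq) orbT.
Qed.

Lemma supp_hall a b e : supp a b e -> hall e.
Proof. by case/and4P. Qed.

Lemma suppP a b e : supp a b e -> exists e1 e2,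
  [/\ e = Node e1 e2, hall (Node e1 e2), a <= e1,
      e1 < b & a < e].
Proof.
case/and4P; case: e => // e1 e2 he /andP[ae1 e1b] _ _.
by exists e1, e2; split=> //; apply: le_lt_trans ae1 (lt_left he).
Qed.

Lemma supp_gt a b e : supp a b e -> a < e.
Proof. by case/suppP => e1 [e2 []]. Qed.

Lemma supp_node a b : hall a -> hall b -> a < b -> left_le b a ->
  supp a b (Node a b).
Proof.
move=> ha hb ab lba; rewrite /supp /= ha hb ab lba lexx eqxx /=.
case: b hb ab lba => //= p b' hb ab; rewrite leNgt => /negbTE -> //.
Qed.

Lemma grows_lt p t b' : grows p t -> t < b' -> t < Node p b'.
Proof.
case: t => //= l r gr tb; rewrite ltNN.
case/orP: gr => [->//|/andP[/eqP lp rt]].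
by rewrite lp eqxx (lt_trans rt tb) orbT.
Qed.

Lemma grows_lt_node p t : grows p t -> t < Node p t.
Proof.
by case: t => //= l r /orP[lp|/andP[/eqP lp rt]]; rewrite ltNN lp ?eqxx ?rt ?orbT.
Qed.

Lemma hallN a b :
  hall (Node a b) = [&& hall a, hall b, a < b & left_le b a].
Proof. by []. Qed.

Lemma nearN p a b :
  near p (Node a b) = (a <= p) || grows p a && left_le b p.
Proof. by []. Qed.

Section Step.
Variables (a p b' : br bool).
Hypotheses (hb : hall (Node p b')) (ap : a < p).

Let hp : hall p. Proof. by case/and4P: hb. Qed.
Let hb' : hall b'. Proof. by case/and4P: hb. Qed.
Let pb' : p < b'. Proof. by case/and4P: hb. Qed.
Let lb'p : left_le b' p. Proof. by case/and4P: hb. Qed.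
Let pb : p < Node p b'. Proof. exact: lt_left. Qed.

Let supp_step e : hall e ->
    (if e is Node e1 _ then a <= e1 < Node p b' else false) ->
  near p e -> supp a (Node p b') e.
Proof.
move=> he e1 nr; rewrite /supp he e1 /= nr implybT andbT /=.
by rewrite leNgt ap.
Qed.

(** Since lambda(c) < p and lambda(b') <= p, the inequality [b' < c] forces lambda(b') < p. Hence
    [b'] grows under [p], which makes [(b', c)] near [p]. *)
Lemma supp_right_gt c : supp a p c -> b' < c -> supp a (Node p b') (Node b' c).
Proof.
move=> /suppP[c1 [c2 [-> hc ac1 c1p ac]]] b'c.
have lb : left_le (Node c1 c2) b' by apply: ltW; apply: lt_trans pb'.
have gb : grows p b'.
  case: (b') pb' lb'p b'c => [y|l r] //= pb1; first by case: y pb1 => //; rewrite lt_x0F.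
  rewrite le_eqVlt ltNN => /orP[/eqP->|->//].
  by rewrite ltNge (ltW c1p) (gt_eqF c1p).
apply: supp_step.
- by rewrite hallN hb' hc b'c lb.
- by rewrite (ltW (lt_trans ap pb')) grows_lt_node.
- by rewrite /= gb (ltW c1p) orbT.
Qed.

(** If lambda(b') <= c, only [(c, b')] occurs. Otherwise c < lambda(b') <= p, and nearness to
    lambda(b') passes to [p]. *)
Lemma supp_right_lt c e : supp a p c -> c < b' -> supp c b' e ->
  supp a (Node p b') e.
Proof.
move=> /suppP[c1 [c2 [-> hc ac1 c1p ac]]] cb' se.
have [e1 [e2 [ee he ce1 e1b ce]]] := suppP se.
have [lb|nlb] := boolP (left_le b' (Node c1 c2)).
  have -> : e = Node (Node c1 c2) b' by case/and4P: se => _ _ /implyP/(_ lb)/eqP.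
  apply: supp_step.
  - by rewrite hallN hb' hc cb' lb.
  - by rewrite (ltW ac) ltNN c1p.
  - by rewrite /= c1p lb'p orbT.
have nr : near p e.
  case: (b') lb'p nlb se => //= q r le_qp lt_cq /and4P[_ _ _ /implyP].
  by rewrite ltNge lt_cq => /(_ isT); apply: near_le.
rewrite ee in nr *; apply: supp_step => //.
rewrite (le_trans (ltW ac) ce1) /=; case/orP: nr => [le1|/andP[gr _]].
  exact: le_lt_trans le1 pb.
exact: grows_lt.
Qed.

Lemma supp_left_gt e1 e2 : supp a b' (Node e1 e2) -> e1 <= p ->
  p < Node e1 e2 -> supp a (Node p b') (Node p (Node e1 e2)).
Proof.
move=> /supp_hall he le1 pe; apply: supp_step.
- by rewrite hallN he hp pe /= le1.
- by rewrite (ltW ap) pb.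
- by rewrite /= lexx.
Qed.

Lemma supp_left_lt e' e : supp a b' e' -> supp e' p e -> supp a (Node p b') e.
Proof.
move=> /supp_gt ae' se'; have [e1 [e2 [-> he le1 e1p _]]] := suppP se'.
apply: supp_step => //.
- by rewrite (le_trans (ltW ae') le1) (lt_trans e1p pb).
- by rewrite /= (ltW e1p).
Qed.

(** * Terms [(e1, e2)] with [p < e1], whose bracket with [p] splits in two *)

Section Far.
Variables e1 e2 : br bool.
Hypotheses (se : supp a b' (Node e1 e2)) (pe1 : p < e1).

Let he : [/\ hall e1, hall e2, e1 < e2 & left_le e2 e1].
Proof. by case/and4P: (supp_hall se). Qed.

Let e1b : e1 < b'. Proof. by case/and4P: se => _ /andP[]. Qed.

(** The case lambda(b') <= a would give e = (a, b') and e1 = a < p. So a < lambda(b') <= p < e1,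
    which leaves only the second alternative of nearness to lambda(b'), and this passes to [p]. *)
Lemma far_grows : grows p e1 && left_le e2 p.
Proof.
have := se; rewrite /supp => /and4P[_ _ /implyP lba].
have lb : ~~ left_le b' a.
  by apply/negP => /lba /eqP[e1a _]; move: pe1; rewrite e1a ltNge (ltW ap).
case: (b') lb'p lb => //= q r le_qp; rewrite -ltNge => -> /=.
by case/orP => [|/andP[gr l2]]; [rewrite leNgt (le_lt_trans le_qp pe1)
  | rewrite (grows_le le_qp gr) (left_lt_trans l2 le_qp)].
Qed.

Lemma far_hall1 : hall (Node p e1).
Proof.
case: he => h1 _ _ _; have /andP[gr _] := far_grows.
rewrite hallN hp h1 pe1 /=; case: (e1) gr => //= l r.
by case/orP => [/ltW//|/andP[/eqP-> _]].
Qed.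

Lemma far_hall2 : hall (Node p e2).
Proof.
case: he => _ h2 e12 _; have /andP[_ l2] := far_grows.
by rewrite hallN hp h2 l2 (lt_trans pe1 e12).
Qed.

Lemma far_grows1 : e1 < Node p e1.
Proof. by have /andP[gr _] := far_grows; apply: grows_lt_node. Qed.

Lemma supp_far_lt : Node p e1 < e2 -> supp a (Node p b') (Node (Node p e1) e2).
Proof.
move=> lt_e2; case: he => _ h2 _ l2; have /andP[gr l2p] := far_grows.
apply: supp_step.
- rewrite hallN far_hall1 h2 lt_e2 /=.
  exact: left_lt_trans l2 (ltW far_grows1).
- by rewrite (ltW (lt_trans ap (lt_left far_hall1))) ltNN e1b eqxx orbT.
- by rewrite nearN l2p /= eqxx far_grows1 !orbT.
Qed.

Lemma supp_far_gt : e2 < Node p e1 -> supp a (Node p b') (Node e2 (Node p e1)).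
Proof.
move=> lt_e2; case: he => _ h2 e12 _; have /andP[gr l2p] := far_grows.
have pe2 := lt_trans pe1 e12.
(* Here lambda(e2) <= p; in case of equality, e2 < (p, e1) gives mu(e2) < e1 < e2. *)
have gr2 : grows p e2.
  move: lt_e2 pe2 e12 l2p; case: (e2) => [[]|l r] //=.
    by rewrite lt_x0F.
  rewrite -/(Node l r < Node p e1) ltNN => + _ e12; rewrite le_eqVlt.
  case/orP => [->//|/andP[lp r1]] _.
  by rewrite lp (lt_trans r1 e12) orbT.
apply: supp_step.
- by rewrite hallN far_hall1 h2 lt_e2 /= ltW.
- rewrite (ltW (lt_trans ap pe2)) /=.
  move: (lt_e2) gr2; case: (e2) => // l r; rewrite !ltNN => + _.
  by case/orP => [->//|/andP[-> /lt_trans->//]]; rewrite orbT.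
- by rewrite nearN gr2 /= lexx orbT.
Qed.

Lemma far_lt2 : e1 < Node p e2.
Proof.
case: he => _ _ e12 _; have /andP[gr _] := far_grows.
exact: grows_lt.
Qed.

Lemma supp_far2 : supp a (Node p b') (Node e1 (Node p e2)).
Proof.
case: he => h1 _ _ _; have /andP[gr l2p] := far_grows.
apply: supp_step.
- by rewrite hallN h1 far_hall2 far_lt2 /= ltW.
- by rewrite (ltW (lt_trans ap pe1)) (grows_lt gr e1b).
- by rewrite nearN gr /= lexx orbT.
Qed.

End Far.
End Step.
End Support.

(** * Antisymmetry and the Leibniz form of the Jacobi identity *)

Section LieIdentities.
Local Open Scope ring_scope.
Variables (K : fieldType) (V : lieAlgType K).
Implicit Types u v w : V.

Lemma lieC u v : lie u v = - lie v u.
Proof.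
apply/eqP; rewrite -addr_eq0; apply/eqP.
have := liexx (u + v); rewrite lieDl !lieDr !liexx addr0 add0r.
by [].
Qed.

Lemma lie_leibniz u v w : lie u (lie v w) = lie (lie u v) w + lie v (lie u w).
Proof.
have /eqP := lie_jacobi u v w; rewrite -addrA addr_eq0 => /eqP->.
by rewrite opprD (lieC w (lie u v)) opprK (lieC w u) -[- lie u w]scaleN1r lieZr scaleN1r opprK addrC.
Qed.

End LieIdentities.

(** * Counting signed sums of trees *)

Section SignedCombinations.
Local Open Scope ring_scope.
Variables (K : fieldType) (V : lieAlgType K) (g : bool -> V).
Implicit Types (u v w : V) (P Q : br bool -> Prop) (m n k : nat).

Fixpoint eval_br (t : br bool) : V :=
  match t with
  | Leaf x => g x
  | Node a b => lie (eval_br a) (eval_br b)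
  end.

(** At most [n] signed trees of [P], repetitions counted, add up to [u]; thus [n] bounds the norm,
    and counts multiply when linear maps are composed. *)
Inductive comb P : nat -> V -> Prop :=
| comb_zero : comb P 0 0
| comb_weaken n u : comb P n u -> comb P n.+1 u
| comb_cons (s : bool) n c u :
    P c -> comb P n u -> comb P n.+1 ((-1) ^+ s *: eval_br c + u).

Lemma comb_le P m n u : (m <= n)%N -> comb P m u -> comb P n u.
Proof.
by move=> /subnKC <-; elim: (n - m)%N => [|d IH] cu; rewrite ?addn0 ?addnS //;
   apply: comb_weaken; apply: IH.
Qed.

Lemma comb0 P n : comb P n 0.
Proof. by apply: comb_le (comb_zero P). Qed.

Lemma combD P m n u v : comb P m u -> comb P n v -> comb P (m + n) (u + v).
Proof.
move=> + cv; elim=> [|{}m {}u _|s {}m c {}u Pc _ IH].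
- by rewrite add0r.
- by move=> ?; apply: comb_weaken.
- by rewrite -addrA; apply: comb_cons.
Qed.

Lemma comb1 P c : P c -> comb P 1 (eval_br c).
Proof.
by move=> Pc; have := comb_cons false Pc (comb_zero P); rewrite expr0 scale1r addr0.
Qed.

Lemma comb1_lie P a b :
  P (Node a b) -> comb P 1 (lie (eval_br a) (eval_br b)).
Proof. exact: comb1. Qed.

Lemma combN P m u : comb P m u -> comb P m (- u).
Proof.
elim=> [|{}m {}u _ IH|s {}m c {}u Pc _ IH].
- by rewrite oppr0; apply: comb_zero.
- exact: comb_weaken.
- by rewrite opprD -scaleNr -signrN; apply: comb_cons.
Qed.

Lemma comb_sub P Q m u : (forall c, P c -> Q c) -> comb P m u -> comb Q m u.
Proof.
move=> PQ; elim=> [|{}m {}u _ IH|s {}m c {}u Pc _ IH].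
- exact: comb_zero.
- exact: comb_weaken.
- by apply: comb_cons; first apply: PQ.
Qed.

Lemma comb_bind P Q m k u (f : V -> V) :
  (forall x y, f (x + y) = f x + f y) -> (forall a x, f (a *: x) = a *: f x) ->
  (forall c, P c -> comb Q k (f (eval_br c))) -> comb P m u ->
  comb Q (m * k) (f u).
Proof.
move=> fD fZ fPQ; elim=> [|{}m {}u _ IH|s {}m c {}u Pc _ IH].
- by rewrite -(scale0r 0) fZ scale0r; apply: comb_zero.
- by apply: comb_le IH; rewrite leq_mul2r leqnSn orbT.
- rewrite fD fZ mulSn; apply: combD IH.
  by case: s; rewrite ?scaleN1r ?expr0 ?scale1r; [apply: combN|]; apply: fPQ.
Qed.

Lemma comb_liel P Q m k u w :
  (forall c, P c -> comb Q k (lie (eval_br c) w)) -> comb P m u ->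
  comb Q (m * k) (lie u w).
Proof.
move=> PQ cu; apply: (comb_bind (f := fun x => lie x w)) PQ cu => *.
  exact: lieDl.
exact: lieZl.
Qed.

Lemma comb_lier P Q m k u w :
  (forall c, P c -> comb Q k (lie w (eval_br c))) -> comb P m u ->
  comb Q (m * k) (lie w u).
Proof.
move=> PQ cu; apply: (comb_bind (f := lie w)) PQ cu => *.
  exact: lieDr.
exact: lieZr.
Qed.

End SignedCombinations.
Arguments comb {K V} g P.

(** * The recurrence for the number of terms of [a, (p, b')] *)

Section Step.
Local Open Scope order_scope.
Variables (K : fieldType) (V : lieAlgType K) (g : bool -> V).
Implicit Types (a b c e p : br bool) (k l m n : nat).

Notation br_lie a b := (lie (eval_br g a) (eval_br g b)).

Lemma comb_node a b : hall a -> hall b -> a < b -> left_le b a ->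
  comb g (supp a b) 1 (br_lie a b).
Proof. by move=> *; apply: comb1_lie; apply: supp_node. Qed.

Variables a p b' : br bool.
Hypotheses (hb : hall (Node p b')) (ap : a < p).

Lemma comb_right c k : (0 < k)%N -> supp a p c ->
  (c < b' -> comb g (supp c b') k (br_lie c b')) ->
  comb g (supp a (Node p b')) k (br_lie c b').
Proof.
move=> k_gt0 sc ck; have [cb|bc|->] := ltgtP c b'.
- by apply: comb_sub (ck cb) => e; apply: supp_right_lt.
- rewrite lieC; apply: combN; apply: comb_le k_gt0 _.
  by apply: comb1_lie; apply: supp_right_gt.
- by rewrite liexx; apply: comb0.
Qed.

(** The resulting trees keep a left factor at most [p], so the count can be iterated. Requiring
    [0 < k] only for [p < e] allows [k = 0] when [e = p], where the bracket vanishes. *)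
Lemma comb_near e k : supp a b' e -> left_le e p -> (p < e -> (0 < k)%N) ->
  (e < p -> comb g (supp e p) k (br_lie e p)) ->
  comb g (fun c => supp a (Node p b') c && left_le c p) k (br_lie p e).
Proof.
move=> se le k_gt0 ek; have [pe|ep|<-] := ltgtP p e.
- apply: comb_le (k_gt0 pe) _; apply: comb1_lie; rewrite /left_le lexx andbT.
  by have [e1 [e2 [ee _ _ _ _]]] := suppP se; subst e; apply: supp_left_gt.
- rewrite lieC; apply: combN; apply: comb_sub (ek ep) => c sc.
  have [c1 [c2 [cE _ _ c1p _]]] := suppP sc.
  by rewrite (supp_left_lt hb ap se sc) cE /= ltW.
- by rewrite liexx; apply: comb0.
Qed.

Lemma comb_far e : supp a b' e -> ~~ left_le e p ->
  comb g (supp a (Node p b')) 2 (br_lie p e).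
Proof.
move=> se; have [e1 [e2 [ee he _ _ _]]] := suppP se; subst e.
rewrite /= -ltNge => pe1; rewrite lie_leibniz; apply: (combD (m := 1) (n := 1)).
  have [lt1|gt1|eq1] := ltgtP (Node p e1) e2.
  - apply: (@comb1_lie _ _ _ _ (Node p e1) e2); exact: supp_far_lt.
  - rewrite lieC; apply: combN; apply: (@comb1_lie _ _ _ _ e2 (Node p e1)).
    exact: supp_far_gt.
  - by rewrite -eq1 /= liexx; apply: comb0.
apply: (@comb1_lie _ _ _ _ e1 (Node p e2)); exact: supp_far2.
Qed.

Lemma comb_left e k : supp a b' e -> (1 < k)%N ->
  (e < p -> comb g (supp e p) k (br_lie e p)) ->
  comb g (supp a (Node p b')) k (br_lie p e).
Proof.
move=> se k_gt1 ek; have [le|nle] := boolP (left_le e p).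
  apply: (comb_sub (P := fun c => supp a (Node p b') c && left_le c p)).
    by move=> c /andP[].
  by apply: comb_near => // _; apply: ltnW.
by apply: comb_le k_gt1 _; apply: comb_far.
Qed.

(** By Leibniz, [a, (p, b')] = [[a, p], b'] + [p, [a, b']]. Each [c, b'] costs [k] terms and each
    [p, e] costs [l]; [1 < l] pays for the terms that split. *)
Lemma comb_step m n k l :
  comb g (supp a p) m (br_lie a p) -> comb g (supp a b') n (br_lie a b') ->
  (0 < k)%N ->
  (forall c, supp a p c -> c < b' -> comb g (supp c b') k (br_lie c b')) ->
  (1 < l)%N ->
  (forall e, supp a b' e -> e < p -> comb g (supp e p) l (br_lie e p)) ->
  comb g (supp a (Node p b')) (m * k + n * l) (br_lie a (Node p b')).
Proof.
move=> cm cn k_gt0 ck l_gt1 cl; rewrite /= lie_leibniz; apply: combD.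
  by apply: comb_liel cm => c sc; apply: comb_right => //; apply: ck.
by apply: comb_lier cn => e se; apply: comb_left => //; apply: cl.
Qed.

End Step.

(** * The recurrence when the right factor is [x1] *)

Section StepX1.
Local Open Scope order_scope.
Variables (K : fieldType) (V : lieAlgType K) (g : bool -> V).
Implicit Types (a b c e p : br bool) (k l m n : nat).
Notation br_lie a b := (lie (eval_br g a) (eval_br g b)).

(** Here [a, x1] is the single tree [(a, x1)], whose left factor is below [p]. It does not split, so
    [l] may be smaller than 2. *)
Lemma comb_step_x1 a p m l : hall a -> hall (Node p x1) -> a < p ->
  comb g (supp a p) m (br_lie a p) -> (p < Node a x1 -> (0 < l)%N) ->
  (Node a x1 < p -> comb g (supp (Node a x1) p) l (br_lie (Node a x1) p)) ->
  comb g (supp a (Node p x1)) (m + l) (br_lie a (Node p x1)).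
Proof.
move=> ha hb ap cm l_gt0 cl; rewrite [eval_br g (Node p x1)]/= lie_leibniz.
have ax : a < x1 by rewrite lt_x1; apply: contraTneq ap => ->; rewrite x1_gtF.
apply: combD.
  rewrite -[m]muln1; apply: (comb_liel (w := g true)) cm => c sc.
  apply: (comb_right hb ap) => // cx; apply: comb_node => //.
  exact: supp_hall sc.
have sa : supp a x1 (Node a x1) by apply: supp_node.
apply: (comb_sub (P := fun c => supp a (Node p x1) c && left_le c p)).
  by move=> c /andP[].
by apply: (comb_near hb ap sa) => //=; apply: ltW.
Qed.

End StepX1.

(** * Fibonacci inequalities matching the recurrences *)

Section Fibonacci.

Lemma fibSS n : fib n.+2 = fib n.+1 + fib n.
Proof. by []. Qed.

Lemma fib_gt0 n : 0 < n -> 0 < fib n.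
Proof.
case: n => // n _; elim: n => // n IH.
by rewrite fibSS ltn_addr.
Qed.

Lemma fibD m n : fib (m + n.+1) = fib m.+1 * fib n.+1 + fib m * fib n.
Proof.
elim: m n => [|m IH] n; first by rewrite add0n mul1n addn0.
by rewrite addSnnS IH !fibSS; nia.
Qed.

Lemma fib_le m n : m <= n -> fib m <= fib n.
Proof.
move/subnKC <-; elim: (n - m) => [|d IH]; rewrite ?addn0 ?addnS //.
apply: leq_trans IH _; case: (m + d) => // p; exact: leq_addr.
Qed.

Lemma expn2_le_fib k : 2 ^ k <= fib (2 * k).+1.
Proof.
elim: k => // k IH; rewrite expnS mulnS !addSn add0n.
by have := fib_le (leqnSn (2 * k)); rewrite !fibSS; lia.
Qed.

(** For [l = 1] the right side is F(i+3) F(j+2) + F(i+2) F(j+1) by the addition formula, and F(i+3)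
    is at least both 2 and F(i+1). *)
Lemma fib_step i j l : 0 < l ->
  fib i.+2 * fib j.+1 + fib j.+2 * maxn 2 (fib i.+1) <= fib (l + i + j).+3.
Proof.
move=> l_gt0; have le_n : i.+2 + j.+2 <= (l + i + j).+3 by lia.
apply: leq_trans (fib_le le_n); have := fib_gt0 (ltn0Sn i).
by rewrite fibD !fibSS; nia.
Qed.

(** The excluded case r = i = 0 is false: its left side is F(j+2) + 2 F(j+1), which exceeds
    F(j+3). *)
Lemma fib_chain_step r i j : (0 < r) || (0 < i) ->
  fib i.+1 * fib j.+2 + fib j.+1 * maxn 2 (fib i.+2) <= fib (r + i + j).+3.
Proof.
have h1 := fib_gt0 (ltn0Sn i); have := fib_gt0 (ltn0Sn j).
case: r => [|r] h2 hi.
  apply: leq_trans (_ : fib (i.+1 + j.+2) <= _); last by apply: fib_le; lia.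
  case: i h1 hi => // i h1 _; have := fib_gt0 (ltn0Sn i).
  by rewrite fibD !fibSS; nia.
have le_n : i.+2 + j.+2 <= (r.+1 + i + j).+3 by lia.
apply: leq_trans (fib_le le_n).
by rewrite fibD !fibSS; nia.
Qed.

Lemma fib_lvl_x1 s l : l < s ->
  fib (s.+1 - l) + fib (s - l) <= fib ((s + 1).+1 - l).
Proof.
move=> /subnKC <-; move: (s - l.+1) => i.
have -> : (l.+1 + i).+1 - l = i.+2 by lia.
have -> : l.+1 + i - l = i.+1 by lia.
by have -> : (l.+1 + i + 1).+1 - l = i.+3 by lia.
Qed.

Lemma fib_lvl_node s t l : 0 < l -> l < s -> l < t ->
  fib (s.+1 - l) * fib (t - l) + fib (t.+1 - l) * maxn 2 (fib (s - l))
    <= fib ((s + t).+1 - l).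
Proof.
move=> l_gt0 /subnKC <- /subnKC <-.
move: (s - l.+1) (t - l.+1) => i j; have := fib_step i j l_gt0.
have -> : (l.+1 + i).+1 - l = i.+2 by lia.
have -> : l.+1 + j - l = j.+1 by lia.
have -> : (l.+1 + j).+1 - l = j.+2 by lia.
have -> : l.+1 + i - l = i.+1 by lia.
by have -> : (l.+1 + i + (l.+1 + j)).+1 - l = (l + i + j).+3 by lia.
Qed.

Lemma leq_fib_subS s l l' : l < l' -> fib (s.+1 - l') <= fib (s - l).
Proof. by move=> lt_l; apply: fib_le; rewrite -[s - l]subSS leq_sub2l. Qed.

Lemma fib_chain_x1 r s : r.+2 < s ->
  fib (s - r.+1) + fib (s - r.+2) <= fib (s + 1 - r.+1).
Proof.
move=> /subnKC <-; move: (s - r.+3) => i.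
have -> : r.+3 + i - r.+1 = i.+2 by lia.
have -> : r.+3 + i - r.+2 = i.+1 by lia.
by have -> : r.+3 + i + 1 - r.+1 = i.+3 by lia.
Qed.

Lemma fib_chain_node r s t : (0 < r) || (r.+2 < s) -> r.+1 < s -> r.+1 < t ->
  fib (s - r.+1) * fib (t - r) + fib (t - r.+1) * maxn 2 (fib (s - r))
    <= fib (s + t - r.+1).
Proof.
rewrite -(subn_gt0 r.+2 s) => /(fib_chain_step (t - r.+2)) + lt_s lt_t.
have -> : s - r.+1 = (s - r.+2).+1 by lia.
have -> : t - r = (t - r.+2).+2 by lia.
have -> : t - r.+1 = (t - r.+2).+1 by lia.
have -> : s - r = (s - r.+2).+2 by lia.
by have -> : s + t - r.+1 = (r + (s - r.+2) + (t - r.+2)).+3 by lia.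
Qed.

Lemma ltn_of_addS m n s : 0 < m -> 0 < s -> m + s < n.+1 -> m < n /\ s < n.
Proof. by lia. Qed.

End Fibonacci.

(** * The bound by level, for [a] other than [x0] *)

Section Bounds.
Local Open Scope order_scope.
Variables (K : fieldType) (V : lieAlgType K) (g : bool -> V).
Implicit Types (a b c e p w : br bool) (k l m n r : nat).

Notation br_lie a b := (lie (eval_br g a) (eval_br g b)).

Lemma lt_neq_x1 a b : a < b -> a != x1.
Proof. by apply: contraTneq => ->; rewrite x1_gtF. Qed.

Lemma supp_lvl a b e : supp a b e -> (lvl a < lvl e)%N.
Proof.
move=> /suppP[e1 [e2 [-> he ae _ _]]]; rewrite ltnS; apply: lvl_le ae.
  by case/and4P: he.
by case/and4P: he => _ _ /lt_neq_x1.
Qed.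

Lemma lvl_gt0 a b : a != x0 -> a < b -> (0 < lvl a)%N.
Proof. by case: a => // [[]] // _; rewrite x1_gtF. Qed.

Lemma size_gt_lvl a b : hall b -> a < b -> b != x1 -> (lvl a < br_size b)%N.
Proof.
by move=> hb ab bx; apply: leq_ltn_trans (lvl_lt_size b); apply: lvl_le (ltW ab).
Qed.

(** Strong induction on |b|. The trees [c] and [e] bracketed in the second stage have a larger level
    than [a], which lowers their Fibonacci index by at least one; [fib_lvl_node] then closes the
    recurrence. *)
Lemma comb_lvl a b : hall a -> hall b -> a != x0 -> b != x1 -> a < b ->
  comb g (supp a b) (fib ((br_size b).+1 - lvl a)) (br_lie a b).
Proof.
have [n] := ubnP (br_size b); elim: n a b => // n IH a b size_b ha hb ax bx ab.
have a_gt0 := lvl_gt0 ax ab; have sb := size_gt_lvl hb ab bx.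
have [lb|nlb] := boolP (left_le b a).
  apply: comb_le (comb_node _ _ _ _ _) => //; apply: fib_gt0.
  by rewrite subn_gt0 ltnW.
case: b bx nlb size_b hb ab sb => [[]|p b'] //= _; rewrite -ltNge => ap size_b.
move=> hb ab sb; have /and4P[hp hb' pb' lb'p] := hb.
have px := lt_neq_x1 pb'; have sp := size_gt_lvl hp ap px.
have [size_p size_b'] := ltn_of_addS (br_size_gt0 p) (br_size_gt0 b') size_b.
have cm := IH a p size_p ha hp ax px ap.
have [b'x|b'x] := eqVneq b' x1.
  rewrite b'x in hb *.
  apply: comb_le (fib_lvl_x1 sp) (comb_step_x1 ha hb ap cm _ _).
    by rewrite fib_gt0 // subn_gt0.
  move=> ep; rewrite -subSS; apply: (IH (Node a x1)) => //.
  by rewrite /= ha andbT lt_x1 (lt_neq_x1 ap).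
have ab' := lt_trans ap pb'; have sb' := size_gt_lvl hb' ab' b'x.
have cn := IH a b' size_b' ha hb' ax b'x ab'.
apply: comb_le (fib_lvl_node a_gt0 sp sb') (comb_step hb ap cm cn _ _ _ _).
- by rewrite fib_gt0 // subn_gt0.
- move=> c sc cb'; apply: comb_le (leq_fib_subS _ (supp_lvl sc)) _.
  apply: IH => //; first exact: supp_hall sc.
  by have [? [? [-> _ _ _]]] := suppP sc.
- by rewrite leq_max.
- move=> e se ep; apply: comb_le (IH e p _ _ _ _ _ _) => //.
  + by rewrite leq_max (leq_fib_subS _ (supp_lvl se)) orbT.
  + exact: supp_hall se.
  + by have [? [? [-> _ _ _]]] := suppP se.
Qed.

End Bounds.

(** * The improved bound for [x0] and the chains above it *)

Section MinimalLetter.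
Local Open Scope order_scope.
Variables (K : fieldType) (V : lieAlgType K) (g : bool -> V).
Implicit Types (a b c e p w : br bool) (k l m n r : nat).

Notation br_lie a b := (lie (eval_br g a) (eval_br g b)).
Notation y1 := (Node x0 x1).
Notation y2 := (Node x0 y1).

Definition pow_y1 k w := iter k (Node y1) w.

(** Left factors [y1] are peeled off until [x1] or a left factor below [y1] is reached. The
    condition on [w] puts [(y2, w)] in the Hall set. *)
Lemma pow_y1_decomp b : hall b -> y1 < b -> left_le b y1 ->
  exists k w, [/\ b = pow_y1 k w, hall w, y1 < w & left_le w y2].
Proof.
elim: b => [[]|l IHl r IHr] hb lt_b le_l //; first by exists 0, x1.
have /and4P[hl hr lr lrl] := hb; move: le_l; rewrite /= le_eqVlt.
case/orP=> [/eqP lE|].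
  rewrite lE in lr lrl *; have [k [w [-> hw y1w lw]]] := IHr hr lr lrl.
  by exists k.+1, w.
case: l hl {IHl} hb lt_b lr lrl => [[]|l1 l2] // hl hb lt_b lr lrl.
  by move: lt_b; rewrite ltNN x1_gtF andbF ltxx.
rewrite ltNN lt_x0F /= => /andP[/eqP l1E l2x]; rewrite l1E in hb hl lt_b lr lrl *.
exists 0, (Node (Node x0 l2) r); split=> //=.
rewrite leNgt ltNN ltxx eqxx /= -leNgt.
(* [l2] is not a letter, and the Hall condition on [(x0, l2)] forces lambda(l2) = x0. Hence l2 <= y1
   and (x0, l2) <= y2. *)
case: l2 hl l2x {hb lt_b lr lrl} => [[]|q1 q2] // /and4P[_ _ _ /= le_q1] _.
have -> : q1 = x0 by apply/eqP; rewrite eq_le le_q1 le_x0.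
by rewrite leNgt ltNN x1_gtF andbF ltxx.
Qed.

Section Powers.
Variable w : br bool.
Hypotheses (hw : hall w) (y1w : y1 < w) (lw : left_le w y2).

Lemma pow_y1_lt k : y1 < pow_y1 k w.
Proof. by elim: k => //= k IH; rewrite ltNN. Qed.

Lemma pow_y1_left k : left_le (pow_y1 k w) y1.
Proof. by case: k => [|k] /=; [apply: left_lt_trans lw _|]. Qed.

Lemma hall_pow_y1 k : hall (pow_y1 k w).
Proof.
elim: k => //= k IH; rewrite -/(pow_y1 k w) IH pow_y1_left.
by have := pow_y1_lt k; rewrite /pow_y1 /= => ->.
Qed.

Lemma left_y1 a : left_le y1 a. Proof. exact: le_x0. Qed.

(* Terms e with lambda(e) <= y1 stay single under the bracket with y1; only
   the others may split in two. *)
Definition low a b e := supp a b e && left_le e y1.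

Lemma comb_low_step a k n u : a < y1 ->
  comb g (low a (pow_y1 k w)) n u ->
  comb g (low a (pow_y1 k.+1 w)) n (lie (eval_br g y1) u).
Proof.
move=> ay cu; rewrite -[n]muln1; apply: comb_lier cu => e /andP[se le].
apply: (comb_near (hall_pow_y1 k.+1) ay se le) => // ey.
by apply: comb_node => //; [apply: supp_hall se|apply: left_y1].
Qed.

Lemma comb_high_step a k n u : a < y1 ->
  comb g (supp a (pow_y1 k w)) n u ->
  comb g (supp a (pow_y1 k.+1 w)) (n * 2) (lie (eval_br g y1) u).
Proof.
move=> ay cu; apply: comb_lier cu => e se.
apply: (comb_left (hall_pow_y1 k.+1) ay se) => // ey.
apply: comb_le (comb_node _ _ _ _ _) => //; first exact: supp_hall se.
exact: left_y1.
Qed.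

(** The bracket [y2, (y1, b)] is [(y2, y1), b] + [y1, [y2, b]]. The first summand is at most one
    tree; the second doubles the unrestricted part [u] and keeps the low tree single, and 1 + 2 (2^k
    - 1) = 2^(k+1) - 1. *)
Lemma comb_y2_pow k : exists2 u, comb g (supp y2 (pow_y1 k w)) (2 ^ k).-1 u &
  comb g (low y2 (pow_y1 k w)) 1 (br_lie y2 (pow_y1 k w) - u)%R.
Proof.
elim: k => [|k [u cu cv]].
  exists 0%R; rewrite ?subr0; first exact: comb0.
  by apply: comb1_lie; rewrite /low supp_node //; apply: lt_trans y1w.
exists (br_lie (Node y2 y1) (pow_y1 k w) + lie (eval_br g y1) u)%R.
  have -> : ((2 ^ k.+1).-1 = 1 + (2 ^ k).-1 * 2)%N.
    by rewrite expnS; have := expn_gt0 2 k; lia.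
  apply: combD (comb_high_step _ cu) => //.
  apply: (comb_right (hall_pow_y1 k.+1)) => // clt.
  apply: comb_node => //; first exact: hall_pow_y1.
  by case: (k) => [|k'] //=; apply: left_lt_trans lw _.
rewrite [eval_br g (pow_y1 k.+1 w)]/= lie_leibniz opprD addrACA subrr add0r.
rewrite -[X in (_ + X)%R]scaleN1r -lieZr scaleN1r -lieDr.
exact: comb_low_step.
Qed.

Lemma comb_y2_pow_le k :
  comb g (supp y2 (pow_y1 k w)) (2 ^ k) (br_lie y2 (pow_y1 k w)).
Proof.
have [u cu cv] := comb_y2_pow k.
rewrite -[lie _ _](subrK u) -(prednK (expn_gt0 2 k : 0 < 2 ^ k)%N) -addn1 addnC.
by apply: combD cu; apply: comb_sub cv => e /andP[].
Qed.

End Powers.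

(** Equal to (k - 1) 2^k + 1; it bounds the trees of [x0, pow_y1 (k+1) x1] that may still split
    under [y1]. *)
Fixpoint high_count k :=
  if k is j.+1 then (high_count j).*2 + (2 ^ j.+1).-1 else 0%N.

Lemma high_count_fib k : (high_count k + k.+1 <= fib (2 * k).+2)%N.
Proof.
(* Since F(2k+4) = 2 F(2k+2) + F(2k+1), this is exactly what the induction step needs. *)
have bound j : (2 ^ j.+1 <= fib (2 * j).+1 + j.+1)%N.
  have le_fib i : (i <= fib (2 * i))%N.
    elim: i => // i IH; rewrite mulnS fibSS.
    by have := fib_gt0 (ltn0Sn (2 * i)); lia.
  elim: j => // j IH; rewrite mulnS expnS !addSn add0n !fibSS.
  by have := le_fib j; lia.
elim: k => // k; have := bound k; rewrite [high_count k.+1]/= mulnS !addSn add0n.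
by have := expn_gt0 2 k.+1; rewrite !fibSS; lia.
Qed.

(** One more [y1] adds [y2, pow_y1 (k+1) x1], with one low tree and 2^(k+1) - 1 others, and brackets
    the earlier trees with [y1]: low ones stay single, the others double. *)
Lemma comb_x0_pow k : exists2 u,
  comb g (supp x0 (pow_y1 k.+1 x1)) (high_count k) u &
  comb g (low x0 (pow_y1 k.+1 x1)) k.+1 (br_lie x0 (pow_y1 k.+1 x1) - u)%R.
Proof.
have hall_pow j := @hall_pow_y1 x1 isT isT isT j.
elim: k => [|k [u cu cv]].
  exists 0%R; first exact: comb0.
  rewrite subr0 /= lie_leibniz liexx addr0.
  apply: (@comb1_lie _ _ _ _ y2 x1); apply/andP; split=> //.
have [v cv1 cv2] := @comb_y2_pow x1 isT isT isT k.+1.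
have lift e : supp y2 (pow_y1 k.+1 x1) e -> supp x0 (pow_y1 k.+2 x1) e.
  by apply: (supp_right_lt (hall_pow k.+2)) => //; apply: supp_node.
exists (v + lie (eval_br g y1) u)%R.
  rewrite [high_count _]/= -muln2 addnC; apply: combD; first exact: comb_sub cv1.
  exact: (@comb_high_step x1 isT isT isT).
rewrite [eval_br g (pow_y1 k.+2 x1)]/= lie_leibniz opprD addrACA.
rewrite -[X in (_ + (_ + X))%R]scaleN1r -lieZr scaleN1r -lieDr -add1n.
apply: combD; last exact: (@comb_low_step x1 isT isT isT).
by apply: comb_sub cv2 => e /andP[se le]; rewrite /low le lift.
Qed.

(** Write [b] as [pow_y1 k w]. For [w = x1] the refined count is needed. Otherwise |w| >= 3, and the
    crude count 2^k + 2 F(|b|-1) suffices because 2^k <= F(2k+1) <= F(|b|-2). *)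
Lemma comb_x0_y1 b : hall (Node y1 b) -> b != x1 ->
  comb g (supp x0 b) (fib (br_size b).-1) (br_lie x0 b) ->
  comb g (supp x0 (Node y1 b)) (fib (br_size b).+1) (br_lie x0 (Node y1 b)).
Proof.
move=> hyb bx cb; have /and4P[_ hb lt_b le_b] := hyb.
have [k [w [bE hw y1w lw]]] := pow_y1_decomp hb lt_b le_b.
have size_pow j t : br_size (pow_y1 j t) = (2 * j + br_size t)%N.
  by elim: j => //= j ->; rewrite mulnS.
have [wx|wx] := eqVneq w x1.
  have -> : Node y1 b = pow_y1 k.+1 x1 by rewrite bE wx.
  have [u cu cv] := comb_x0_pow k.
  rewrite -[lie _ _](subrK u) bE wx size_pow addn1.
  apply: comb_le (high_count_fib k) _; rewrite addnC.
  by apply: combD cu; apply: comb_sub cv => e /andP[].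
have size_w : (2 < br_size w)%N.
  case: (w) wx y1w hw => [[]|[[]|l1 l2] r] // _; rewrite ltNN.
  - by move=> _ /and4P[_ _]; rewrite x1_gtF.
  - by rewrite ltxx x1_gtF andbF.
  move=> _ _ /=.
  have := br_size_gt0 l1; have := br_size_gt0 l2; have := br_size_gt0 r.
  lia.
have cy : comb g (supp y2 b) (2 ^ k) (br_lie y2 b).
  by rewrite bE; apply: comb_y2_pow_le.
apply: (@comb_le _ _ _ _ (2 ^ k + fib (br_size b).-1 * 2)).
  have := expn2_le_fib k; rewrite bE size_pow.
  case: (br_size w) size_w => [|[|[|s]]] // _ le_k.
  have le_ks : ((2 * k).+1 <= (2 * k + s).+1)%N by rewrite ltnS leq_addr.
  move: (leq_trans le_k (fib_le le_ks)); rewrite !addnS [(_.+3).-1]/=.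
  by rewrite [fib (_ + _).+4]fibSS [fib (_ + _).+3]fibSS; lia.
rewrite [eval_br g (Node y1 b)]/= lie_leibniz; apply: combD.
  apply: comb_sub cy => e; apply: (@supp_right_lt x0 y1 b hyb isT y2 e) => //.
  by apply: lt_trans lt_b.
apply: comb_lier cb => e se; apply: (comb_left hyb _ se) => // ey.
apply: comb_le (comb_node _ _ _ _ _) => //; first exact: supp_hall se.
exact: left_y1.
Qed.

(** The tree G_r, of least size r + 1 among the trees of level r. *)
Fixpoint chain r := if r is s.+1 then Node (chain s) x1 else x0.

Lemma hall_chain r : hall (chain r).
Proof. by elim: r => //= r ->; rewrite andbT lt_x1; case: r. Qed.

Lemma lvl_chain r : lvl (chain r) = r.
Proof. by elim: r => //= r ->. Qed.

Lemma size_chain r : br_size (chain r) = r.+1.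
Proof. by elim: r => //= r ->; rewrite addn1. Qed.

Lemma chain_lt_size r b : hall b -> b != x1 -> chain r < b ->
  b = chain r.+1 \/ (r.+3 <= br_size b)%N.
Proof.
elim: r b => [|r IH] [[]|b1 b2] // hb _ lt_b; have /and4P[h1 h2 lt12 _] := hb.
  case: b1 b2 h1 h2 lt12 {hb lt_b} => [[]|b1 b1'] [[]|b2 b2'] //=; try by left.
  - by right; have := br_size_gt0 b2; have := br_size_gt0 b2'; lia.
  - by right; have := br_size_gt0 b1; have := br_size_gt0 b1'; lia.
  - right; have := br_size_gt0 b1; have := br_size_gt0 b1'.
    by have := br_size_gt0 b2; lia.
(* The right factor [x1] of the chain is maximal, so a strict comparison is decided by the left
   factors. *)
move: lt_b; rewrite /= ltNN x1_gtF andbF orbF => lt1.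
case: (IH b1 h1 (lt_neq_x1 lt12) lt1) => [b1E|size_b1]; last first.
  by right; have := br_size_gt0 b2; lia.
case: b2 lt12 {h2 hb} => [[]|b2 b2']; rewrite ?lt_x0F // => _.
  by left; rewrite b1E.
right; rewrite b1E.
by rewrite /= -/(chain r.+1) size_chain; have := br_size_gt0 b2; have := br_size_gt0 b2'; lia.
Qed.

(** All [r] are treated together, because [b' = x1] leads from G_r to (G_r, x1) = G_(r+1). For other
    [b'] the brackets of the second stage start from trees other than [x0], so [comb_lvl] covers
    them. *)
Lemma comb_chain r b : hall b -> b != x1 -> chain r < b ->
  comb g (supp (chain r) b) (fib (br_size b - r.+1)) (br_lie (chain r) b).
Proof.
have [n] := ubnP (br_size b); elim: n r b => // n IH r b size_b hb bx ab.
have hr := hall_chain r.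
have sb : (r.+1 < br_size b)%N.
  by case: (chain_lt_size hb bx ab) => [->|/ltnW//]; rewrite size_chain.
have [lb|nlb] := boolP (left_le b (chain r)).
  by apply: comb_le (comb_node _ _ _ _ _) => //; rewrite fib_gt0 ?subn_gt0.
case: b bx nlb size_b hb ab sb => [[]|p b'] //=.
move=> _; rewrite -ltNge => ap size_b hb ab sb.
have /and4P[hp hb' pb' lb'p] := hb.
have px := lt_neq_x1 pb'.
have [size_p size_b'] := ltn_of_addS (br_size_gt0 p) (br_size_gt0 b') size_b.
have cm := IH r p size_p hp px ap.
have p0 : (0 < br_size p)%N := br_size_gt0 p.
have lvl_supp e q : supp (chain r) q e -> (r < lvl e)%N /\ e != x0.
  move=> se; split; first by rewrite -[r in (r < _)%N]lvl_chain; apply: supp_lvl se.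
  by have [? [? [-> _ _ _]]] := suppP se.
have [b'x|b'x] := eqVneq b' x1.
  rewrite b'x in hb sb *.
  have [pE|size_p3] := chain_lt_size hp px ap.
    (* Here [p] is (G_r, x1) itself, so [p, [G_r, x1]] vanishes. *)
    apply: comb_le (comb_step_x1 (l := 0) hr hb ap cm _ _); last 2 first.
    - by rewrite pE /= ltxx.
    - by rewrite pE /= ltxx.
    by rewrite addn0; apply: fib_le; rewrite leq_sub2r ?leq_addr.
  apply: comb_le (fib_chain_x1 size_p3) (comb_step_x1 hr hb ap cm _ _).
  - by move=> _; rewrite fib_gt0 // subn_gt0.
  - exact: (IH r.+1).
have ab' := lt_trans ap pb'; have cn := IH r b' size_b' hb' b'x ab'.
have size_r q : hall q -> q != x1 -> chain r < q -> (r.+2 <= br_size q)%N.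
  by move=> hq qx rq; case: (chain_lt_size hq qx rq) => [->|/ltnW//];
     rewrite size_chain.
have sp := size_r p hp px ap; have sb' := size_r b' hb' b'x ab'.
(* For [r = 0] and [p = y1] the Fibonacci inequality fails, and the separate count takes over. *)
have [/andP[/eqP r0 /eqP py]|r_or_p] := boolP ((r == 0%N) && (p == y1)).
  subst r p; have -> : (br_size y1 + br_size b' - 1 = (br_size b').+1)%N.
    by rewrite /= -addnA add1n subn1 /= add1n.
  by apply: comb_x0_y1 => //; rewrite -subn1.
have gt0 : ((0 < r) || (r.+2 < br_size p))%N.
  rewrite lt0n; move: r_or_p; rewrite negb_and => /orP[->//|py].
  case: (chain_lt_size hp px ap) => [pE|->]; last by rewrite orbT.
  by case: (r) pE py => // ->; rewrite eqxx.
apply: comb_le (fib_chain_node gt0 sp sb') (comb_step hb ap cm cn _ _ _ _).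
- by rewrite fib_gt0 // subn_gt0 ltnW.
- move=> c sc cb'; have [lc c0] := lvl_supp _ _ sc.
  apply: comb_le (leq_fib_subS _ lc) (comb_lvl _ _ _ _ _ _) => //.
  exact: supp_hall sc.
- by rewrite leq_max.
- move=> e se ep; have [le e0] := lvl_supp _ _ se.
  apply: comb_le (comb_lvl _ _ _ _ _ _) => //.
    by rewrite leq_max (leq_fib_subS _ le) orbT.
  exact: supp_hall se.
Qed.

End MinimalLetter.

(** * The semidirect product of a Lie algebra by a derivation *)

Section Semidirect.
Local Open Scope ring_scope.
Variables (K : fieldType) (L : lieAlgType K) (D : {linear L -> L}).
Definition derivation := forall u v, D (lie u v) = lie (D u) v + lie u (D v).

Hypothesis DL : derivation.

(** The first component of [(u, r), [(v, s), (w, t)]], expanded by the Leibniz rule. *)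
Let expand (u v w : L) (r s t : K) : L :=
  lie u (lie v w) + s *: lie u (D w) - t *: lie u (D v)
  + r *: lie (D v) w + r *: lie v (D w) + (r * s) *: D (D w) - (r * t) *: D (D v).

Let expandE (u v w : L) (r s t : K) :
  let p := lie v w + s *: D w - t *: D v in
  lie u p + r *: D p - 0 *: D u = expand u v w r s t.
Proof.
move=> p; rewrite scale0r subr0 /expand.
have -> : lie u p = lie u (lie v w) + s *: lie u (D w) - t *: lie u (D v).
  by rewrite /p !lieDr lieZr -scaleNr lieZr scaleNr.
have -> : D p = lie (D v) w + lie v (D w) + s *: D (D w) - t *: D (D v).
  by rewrite /p linearB linearD /= DL !linearZ.
by rewrite scalerBr !scalerDr !scalerA !addrA.
Qed.

(** The proof that [D] is a derivation is an argument of the type, so that the Lie structure can be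
    inferred from the type. *)
Definition semidirect of derivation := (L * K^o)%type.
Notation S := (semidirect DL).

HB.instance Definition _ := GRing.Lmodule.copy S (L * K^o)%type.

Definition semidirect_lie (x y : S) : S :=
  (lie x.1 y.1 + (x.2 : K) *: D y.1 - (y.2 : K) *: D x.1, 0).

Fact semidirect_lieDl u v w :
  semidirect_lie (u + v) w = semidirect_lie u w + semidirect_lie v w.
Proof.
congr pair; rewrite ?addr0 //= lieDl scalerDl linearD scalerDr opprD.
by rewrite (AC (2*2*2) (1*3*5*(2*4*6))).
Qed.

Fact semidirect_lieZl a u v :
  semidirect_lie (a *: u) v = a *: semidirect_lie u v.
Proof.
congr pair; rewrite ?scaler0 //= lieZl.
have -> : D (a *: u.1) = a *: D u.1 by rewrite linearZ.
by rewrite scalerBr scalerDr !scalerA [v.2 * a]mulrC.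
Qed.

Fact semidirect_liexx u : semidirect_lie u u = 0.
Proof. by congr pair; rewrite liexx add0r subrr. Qed.

Fact semidirect_lieC u v : semidirect_lie u v = - semidirect_lie v u.
Proof. by congr pair; rewrite ?oppr0 //= lieC !opprD opprK addrAC. Qed.

Fact semidirect_lieDr u v w :
  semidirect_lie u (v + w) = semidirect_lie u v + semidirect_lie u w.
Proof. by rewrite !(semidirect_lieC u) semidirect_lieDl opprD. Qed.

Fact semidirect_lieZr a u v :
  semidirect_lie u (a *: v) = a *: semidirect_lie u v.
Proof. by rewrite !(semidirect_lieC u) semidirect_lieZl scalerN. Qed.

Fact semidirect_jacobi u v w :
  semidirect_lie u (semidirect_lie v w) + semidirect_lie v (semidirect_lie w u)
    + semidirect_lie w (semidirect_lie u v) = 0.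
Proof.
case: u v w => [u r] [v s] [w t].
have -> : semidirect_lie (u, r) (semidirect_lie (v, s) (w, t))
  + semidirect_lie (v, s) (semidirect_lie (w, t) (u, r))
  + semidirect_lie (w, t) (semidirect_lie (u, r) (v, s)) =
  (expand u v w r s t + expand v w u s t r + expand w u v t r s, 0).
  congr pair; last by rewrite /= !addr0.
  by rewrite -!expandE.
congr pair.
rewrite /expand [s * r]mulrC [t * r]mulrC [t * s]mulrC.
rewrite (lieC (D v) w) (lieC (D w) u) (lieC (D u) v) !scalerN.
(* Of the 21 terms, three form the Jacobi sum of [L] and the other eighteen cancel in pairs. *)
rewrite (AC (7*7*7) ((1*8*15)*(2*11)*(3*19)*(4*16)*(5*10)*(9*18)*(12*17)*(6*14)*(20*7)*(13*21))).
by rewrite /= !subrr !addNr !addr0 lie_jacobi.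
Qed.

HB.instance Definition _ := Lmodule_isLie.Build K S semidirect_lieDl
  semidirect_lieZl semidirect_lieDr semidirect_lieZr semidirect_liexx
  semidirect_jacobi.

End Semidirect.

(** * The derivation sending each letter t to (b, t) *)

Section NodeDerivation.
Local Open Scope ring_scope.
Variables (K : fieldType) (X : Type) (b : br X).
Notation L := (free_lie K (br X)).

(** A derivation is not a Lie morphism, so the universal property does not give it directly; the
    Leibniz rule is imposed on terms and shown to respect the congruence. *)
Fixpoint node_der_term (t : lie_term K (br X)) : L :=
  match t with
  | LVar x => lie_gen K (Node b x)
  | LZero => 0
  | LAdd t u => node_der_term t + node_der_term u
  | LScale a t => a *: node_der_term t
  | LBracket t u => lie (node_der_term t) (flie u) + lie (flie t) (node_der_term u)
  end.

Lemma node_der_cong t u : lie_cong t u -> node_der_term t = node_der_term u.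
Proof.
elim=> //=.
- by move=> ? ? ? _ -> _ ->.
- by move=> ? ? ? ? _ -> _ ->.
- by move=> ? ? ? _ ->.
- by move=> t1 t2 u1 u2 /flieP-> -> /flieP-> ->.
- by move=> *; rewrite addrA.
- by move=> *; rewrite addrC.
- by move=> *; rewrite add0r.
- by move=> *; rewrite scaleN1r addNr.
- by move=> *; rewrite scalerA.
- by move=> *; rewrite scale1r.
- by move=> *; rewrite scalerDr.
- by move=> *; rewrite scalerDl.
- by move=> *; rewrite flieD !lieDl addrACA.
- by move=> *; rewrite flieZ !lieZl scalerDr.
- by move=> *; rewrite flieD !lieDr addrACA.
- by move=> *; rewrite flieZ !lieZr scalerDr.
- by move=> *; rewrite [X in _ + X]lieC subrr.
- move=> t1 t2 t3; rewrite !flieL !lieDr.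
  rewrite (AC ((1*2)*(1*2)*(1*2)) ((1*6*8)*(2*4*9)*(3*5*7))) /=.
  by rewrite !lie_jacobi !addr0.
Qed.

Definition node_der (x : L) : L := node_der_term (repr x).

Lemma node_derE t : node_der (flie t) = node_der_term t.
Proof. by apply: node_der_cong; apply: repr_flie. Qed.

Lemma node_der_gen x : node_der (lie_gen K x) = lie_gen K (Node b x).
Proof. exact: node_derE. Qed.

Fact node_der_linear : linear node_der.
Proof.
by move=> a; elim/flie_ind=> t; elim/flie_ind=> u; rewrite -flieZ -flieD !node_derE.
Qed.

HB.instance Definition _ := GRing.isLinear.Build K L L *:%R node_der node_der_linear.

Lemma node_der_derivation : derivation node_der.
Proof.
by elim/flie_ind=> t; elim/flie_ind=> u /=; rewrite -flieL !node_derE.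
Qed.

End NodeDerivation.

(** * Linear independence of a Hall set by Lazard elimination *)

Section Independence.
Local Open Scope ring_scope.
Variables (K : fieldType) (X : choiceType).
Variables (B : set (br X)) (lt : br X -> br X -> Prop).
Hypothesis hallB : hall_set B lt.
Notation L := (free_lie K (br X)).
Implicit Types (b c t : br X) (s D : seq (br X)).

(* Evaluation in the free Lie algebra on trees, where every tree t whose left
   factor lies in D counts as a letter: the alphabet reached after Lazard
   elimination of the elements of D. *)
Fixpoint eval_from D t : L :=
  match t with
  | Leaf x => lie_gen K t
  | Node l r => if l \in D then lie_gen K t else lie (eval_from D l) (eval_from D r)
  end.

Definition letter_from D t := if t is Node l _ then l \in D else true.

Lemma eval_from_letter D t : letter_from D t -> eval_from D t = lie_gen K t.
Proof. by case: t => //= l r ->. Qed.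

Notation S b := (semidirect (@node_der_derivation K X b)).

(** The letter [b] becomes the adjoined element (0, 1), which acts by t -> (b, t); the other letters
    are kept. *)
Definition eliminate b : L -> S b :=
  @lie_lift K (br X) (S b) (fun t => if t == b then (0, 1) else (lie_gen K t, 0)).

HB.instance Definition _ b := GRing.Linear.on (eliminate b).

Lemma hall_subtree l r : B (Node l r) -> [/\ B l, B r, lt l r & lt l (Node l r)].
Proof.
move=> Blr; have [Bl Br ltlr _] := (hall_node hallB l r).1 Blr.
by split=> //; exact: (hall_lt_node hallB Bl Br Blr).
Qed.

Definition subtree_closed s := forall l r, Node l r \in s -> l \in s /\ r \in s.

(** A node (l, r) that is not yet a letter has either l = b, where [(0, 1), (r, 0)] yields the
    letter (b, r), or both factors different from b, where induction applies. *)
Lemma eliminateE D s b t : subtree_closed (D ++ s) ->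
  (forall c, c \in D ++ s -> B c) ->
  (forall c d, c \in D -> d \in s -> lt c d) -> b \in s ->
  (forall c, c \in s -> c <> b -> lt b c) ->
  t \in s -> t <> b ->
  eliminate b (eval_from D t) = (eval_from (b :: D) t, 0).
Proof.
move=> closed_Ds Ds_B D_s bs bmin; elim: t => [x|l IHl r IHr] ts tb.
  by rewrite /= /eliminate lie_lift_gen; case: eqP tb.
have tDs : Node l r \in D ++ s by rewrite mem_cat ts orbT.
have [lDs rDs] := closed_Ds _ _ tDs.
have [Bl Br ltlr _] := hall_subtree (Ds_B _ tDs).
have Bb : B b by apply: Ds_B; rewrite mem_cat bs orbT.
have below_b q : q \in D ++ s -> lt q b -> q \in D.
  rewrite mem_cat => /orP[//|qs] lt_qb; have Bq : B q.
    by apply: Ds_B; rewrite mem_cat qs orbT.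
  have [qb|/eqP qb] := eqVneq q b.
    by rewrite qb in lt_qb; case: (hall_irr hallB Bb).
  by case: (hall_irr hallB Bb); apply: (hall_trans hallB Bb Bq Bb) lt_qb; apply: bmin.
rewrite [eval_from D _]/= [eval_from (b :: D) _]/= inE.
have [lD|lD] := boolP (l \in D).
  by rewrite orbT /eliminate lie_lift_gen; case: eqP tb.
have ls : l \in s by move: lDs; rewrite mem_cat (negbTE lD).
have rs : r \in s.
  move: rDs; rewrite mem_cat => /orP[rD|//]; case: (hall_irr hallB Bl).
  exact: (hall_trans hallB Bl Br Bl ltlr) (D_s _ _ rD ls).
have rb : r <> b.
  move=> rb; rewrite rb in ltlr; case/negP: lD; exact: below_b.
rewrite /eliminate lie_lift_lie -!/(eliminate b _) (IHr rs rb) orbF.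
have [lb|/eqP lb] := eqVneq l b; last first.
  by rewrite IHl //; congr pair; rewrite scale0r !scale0r addr0 subr0.
have letter_b : letter_from D b.
  case bE: (b) => [//|q q'] /=.
  have bDs : Node q q' \in D ++ s by rewrite -bE mem_cat bs orbT.
  have [qDs _] := closed_Ds _ _ bDs; have [_ _ _ ltq] := hall_subtree (Ds_B _ bDs).
  by apply: below_b; rewrite // bE.
(* By the Hall condition, [r] is a leaf or lambda(r) <= l = b; so lambda(r) is [b] or already
   eliminated. *)
have letter_r : letter_from (b :: D) r.
  have [_ _ _ ] := (hall_node hallB l r).1 (Ds_B _ tDs).
  case=> [[x -> //]|[q [q' [rE q_l]]]]; rewrite rE /= inE.
  case: q_l => [->|lt_ql]; first by rewrite lb eqxx.
  apply/orP; right; apply: below_b; last by rewrite -lb.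
  by move: rDs; rewrite rE => /closed_Ds[].
rewrite lb !eval_from_letter // /eliminate lie_lift_gen eqxx.
congr pair; rewrite /= linear0 scaler0 subr0 scale1r.
have lie0 : lie 0 (lie_gen K r) = 0.
  by have := lieZl (0 : K) (lie_gen K r) (lie_gen K r); rewrite !scale0r.
rewrite lie0.
by rewrite add0r node_der_gen.
Qed.

Lemma semidirect_sum b s (P : pred (br X)) (f : br X -> K) (e : br X -> L) :
  \sum_(c <- s | P c) f c *: ((e c, 0) : S b) = (\sum_(c <- s | P c) f c *: e c, 0).
Proof.
elim/big_rec2: _ => // c x y _ ->.
by congr pair; change (f c * 0 + 0 = 0 :> K); rewrite mulr0 addr0.
Qed.

Lemma hall_min s : (forall c, c \in s -> B c) -> s != [::] ->
  exists2 b, b \in s & forall c, c \in s -> c <> b -> lt b c.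
Proof.
elim: s => // a s IH sB _; have [->|/IH[c cs|b bs bmin]] := eqVneq s [::].
- by exists a => [|c]; rewrite inE ?eqxx // => /eqP-> [].
- by apply: sB; rewrite inE cs orbT.
have Ba : B a by apply: sB; rewrite mem_head.
have Bs c : c \in s -> B c by move=> cs; apply: sB; rewrite inE cs orbT.
have Bb := Bs b bs.
case: (hall_total hallB Ba Bb) => [lt_ab|ab|lt_ba].
- exists a => [|c]; first exact: mem_head.
  rewrite inE => /orP[/eqP->//|cs] _; have [->//|/eqP cb] := eqVneq c b.
  exact: (hall_trans hallB Ba Bb (Bs c cs) lt_ab) (bmin c cs cb).
- exists a => [|c]; first exact: mem_head.
  by rewrite inE => /orP[/eqP->//|cs]; rewrite ab; apply: bmin.
- exists b => [|c]; first by rewrite inE bs orbT.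
  by rewrite inE => /orP[/eqP->//|]; apply: bmin.
Qed.

(** Induction on the size of [s]. Eliminating the least [b] of [s] shows [f b = 0] in the second
    component and leaves, in the first, a relation for [b :: D] and the rest of [s]. *)
Lemma eval_from_independent D s (f : br X -> K) : uniq s ->
  subtree_closed (D ++ s) -> (forall c, c \in D ++ s -> B c) ->
  (forall c d, c \in D -> d \in s -> lt c d) ->
  \sum_(c <- s) f c *: eval_from D c = 0 -> forall c, c \in s -> f c = 0.
Proof.
have [n] := ubnP (size s); elim: n D s => // n IH D s size_s uniq_s closed_Ds Ds_B D_s.
move=> sum0 c cs.
have sB d : d \in s -> B d by move=> ds; apply: Ds_B; rewrite mem_cat ds orbT.
have s0 : s != [::] by case: (s) cs.
have [b bs bmin] := hall_min sB s0.
have letter_b : letter_from D b.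
  case bE: (b) => [//|q q'] /=.
  have bDs : Node q q' \in D ++ s by rewrite -bE mem_cat bs orbT.
  have [] := closed_Ds _ _ bDs; rewrite mem_cat => /orP[//|qs] _.
  have [Bq Bq' _ ltq] := hall_subtree (Ds_B _ bDs).
  have Bb := sB b bs; rewrite -bE in ltq.
  have [qb|/eqP qb] := eqVneq q b.
    by rewrite qb in ltq; case: (hall_irr hallB Bb).
  case: (hall_irr hallB Bb).
  exact: (hall_trans hallB Bb Bq Bb (bmin q qs qb)) ltq.
have := congr1 (@eliminate b) sum0; rewrite linear0 linear_sum /=.
rewrite (bigD1_seq b) //= linearZ /= eval_from_letter // {1}/eliminate lie_lift_gen eqxx.
rewrite big_seq_cond.
rewrite (eq_bigr (fun d => f d *: ((eval_from (b :: D) d, 0) : S b))); last first.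
  move=> d /andP[ds /eqP db]; rewrite linearZ /=; congr (_ *: _).
  exact: (eliminateE closed_Ds).
rewrite -big_seq_cond semidirect_sum => sum_b.
have fb : f b = 0 by have := congr1 snd sum_b; rewrite /= addr0 [_ *: _]mulr1.
have [->//|cb] := eqVneq c b.
apply: (IH (b :: D) (rem b s)).
- by rewrite size_rem //; move: size_s; case: (s) bs.
- exact: rem_uniq.
- move=> l r; have eq_mem d : (d \in (b :: D) ++ rem b s) = (d \in D ++ s).
    rewrite !(mem_cat, inE) mem_rem_uniq // inE.
    by have [->|] := eqVneq d b; rewrite ?bs ?orbT.
  by rewrite !eq_mem; apply: closed_Ds.
- move=> d; rewrite !(mem_cat, inE) => /orP[/orP[/eqP->|dD]|/mem_rem ds].
  + exact: sB.
  + by apply: Ds_B; rewrite mem_cat dD.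
  + exact: sB.
- move=> d e; rewrite inE => /orP[/eqP->|dD]; rewrite mem_rem_uniq // inE => /andP[/eqP eb es].
    exact: bmin.
  exact: D_s.
- have := congr1 fst sum_b; rewrite /= scaler0 add0r => sum_s.
  by rewrite rem_filter // big_filter.
- by rewrite mem_rem_uniq // inE cb.
Qed.

Fixpoint subtrees t : seq (br X) :=
  t :: (if t is Node l r then subtrees l ++ subtrees r else [::]).

Lemma subtrees_refl t : t \in subtrees t.
Proof. by case: t => * /=; rewrite mem_head. Qed.

Lemma subtrees_closed t : subtree_closed (subtrees t).
Proof.
elim: t => [x|a IHa b IHb] l r /=; rewrite !inE //= mem_cat.
case/orP=> [/eqP[-> ->]|/orP[/IHa|/IHb] []]; rewrite !mem_cat.
- by rewrite !subtrees_refl !orbT.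
- by move=> -> ->; rewrite !orbT.
- by move=> -> ->; rewrite !orbT.
Qed.

Lemma hall_subtrees t c : B t -> c \in subtrees t -> B c.
Proof.
elim: t => [x|a IHa b IHb] Bt /=; rewrite !inE ?orbF //= ?mem_cat.
  by move/eqP->.
have [Ba Bb _ _] := hall_subtree Bt.
by case/orP=> [/eqP->//|/orP[]]; [apply: IHa|apply: IHb].
Qed.

(** Elimination needs a set closed under subtrees, so [s] is enlarged with zero coefficients; the
    morphism x -> Leaf x turns [ev] into [eval_from [::]]. *)
Theorem hall_set_free s (f : br X -> K) : uniq s ->
  (forall c, c \in s -> B c) -> \sum_(c <- s) f c *: ev K c = 0 ->
  forall c, c \in s -> f c = 0.
Proof.
move=> uniq_s sB sum0 c cs.
pose R := undup (flatten [seq subtrees t | t <- s]).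
have RP d : reflect (exists2 t, t \in s & d \in subtrees t) (d \in R).
  rewrite mem_undup; apply: (iffP flatten_mapP) => [] [t ts dt]; exists t => //.
have sR d : d \in s -> d \in R by move=> ds; apply/RP; exists d => //; apply: subtrees_refl.
pose f' d := if d \in s then f d else 0.
have phi_ev t : @lie_lift K X L (fun x => lie_gen K (Leaf x)) (ev K t) = eval_from [::] t.
  elim: t => [x|l IHl r IHr]; first exact: lie_lift_gen.
  by rewrite [ev K _]/= lie_lift_lie IHl IHr.
have sum0' : \sum_(d <- R) f' d *: eval_from [::] d = 0.
  transitivity (\sum_(d <- R | d \in s) f d *: eval_from [::] d).
    rewrite [RHS]big_mkcond; apply: eq_bigr => d _; rewrite /f'.
    by case: ifP => //; rewrite scale0r.
  rewrite -big_filter (perm_big s) /=.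
    have := congr1 (@lie_lift K X L (fun x => lie_gen K (Leaf x))) sum0.
    rewrite linear0 linear_sum /= => sum_ev; rewrite -[RHS]sum_ev.
    by apply: eq_bigr => d _; rewrite linearZ /= phi_ev.
  apply: uniq_perm => //; first by rewrite filter_uniq // undup_uniq.
  by move=> d; rewrite mem_filter; apply/andP/idP => [[]//|ds]; rewrite sR.
have := @eval_from_independent [::] R f' (undup_uniq _) _ _ _ sum0' c (sR c cs).
rewrite /f' cs; apply => //.
  move=> l r /RP[t ts /subtrees_closed[lt_t rt_t]].
  by split; apply/RP; exists t.
by move=> d /RP[t ts]; apply: hall_subtrees; apply: sB.
Qed.

End Independence.

(** * The bound F(n - 2) for all pairs, over the letters [x0] and [x1] *)

Lemma comb_fib (K : fieldType) (V : lieAlgType K) (g : bool -> V) a b :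
  hall a -> hall b -> (a < b)%O -> 3 <= br_size a + br_size b ->
  comb g hall (fib (br_size a + br_size b - 2)) (lie (eval_br g a) (eval_br g b)).
Proof.
move=> ha hb ab size_ab; have supp_hall_sub := @supp_hall a b.
apply: comb_sub supp_hall_sub _.
have [bx|bx] := eqVneq b x1.
  rewrite bx in hb ab size_ab *; apply: comb_le (comb_node _ _ _ _ _) => //.
  by rewrite fib_gt0 // subn_gt0.
have [ax|ax] := eqVneq a x0.
  rewrite ax in ab size_ab *; apply: comb_le (comb_chain (r := 0) g hb bx ab).
  by rewrite add1n subSS.
(* Now |a| >= 2 and lvl a >= 1, so |b| + 1 - lvl a <= |a| + |b| - 2. *)
apply: comb_le (comb_lvl g ha hb ax bx ab); apply: fib_le.
have lvl_a := lvl_gt0 ax ab; have := lvl_lt_size a.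
by move: (lvl a) (br_size a) (br_size b) lvl_a => [|l] //= *; lia.
Qed.

(** * Uniqueness of Hall expansions and bounds on the norm *)

Section HallNorm.
Local Open Scope ring_scope.
Variables (K : numFieldType) (X : choiceType).
Variables (B : set (br X)) (lt : br X -> br X -> Prop).
Hypothesis hallB : hall_set B lt.
Implicit Types (u : free_lie K X) (alpha : {fsfun br X -> K with 0}).

Lemma hall_expansion_uniq u alpha beta :
  hall_expansion B u alpha -> hall_expansion B u beta -> alpha = beta.
Proof.
move=> [aB ua] [bB ub]; pose s := (finsupp alpha `|` finsupp beta)%fset.
have sum_s (gamma : {fsfun br X -> K with 0}) : (finsupp gamma `<=` s)%fset ->
    \sum_(c <- finsupp gamma) gamma c *: ev K c = \sum_(c <- s) gamma c *: ev K c.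
  move=> sub; apply: big_fset_incl => // c _; rewrite mem_finsupp negbK => /eqP->.
  by rewrite scale0r.
have free_s := @hall_set_free K X B lt hallB s (fun c => alpha c - beta c).
apply/fsfunP => c; have [cs|] := boolP (c \in s); last first.
  by rewrite inE negb_or !mem_finsupp !negbK => /andP[/eqP-> /eqP->].
apply/eqP; rewrite -subr_eq0; apply/eqP; apply: free_s cs; first exact: fset_uniq.
  by move=> d; rewrite inE => /orP[/aB|/bB].
under eq_bigr do rewrite scalerBl.
rewrite sumrB -!sum_s ?fsubsetUl ?fsubsetUr //.
by rewrite -ua -ub subrr.
Qed.

Lemma hall_norm_le u (s : seq (br X)) (f : br X -> K) (m : K) : uniq s ->
  (forall c, c \in s -> B c) -> u = \sum_(c <- s) f c *: ev K c ->
  \sum_(c <- s) `|f c| <= m -> (hall_norm B u <= m%:E)%E.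
Proof.
move=> uniq_s sB us sm.
pose alpha : {fsfun br X -> K with 0} := [fsfun c in seq_fset tt s => f c | 0].
(* The support of [alpha] can be smaller than [s], as [f] may vanish; [F 0 c = 0] makes this
   harmless, both for the expansion and for the norm. *)
have sum_alpha (W : zmodType) (F : K -> br X -> W) : (forall c, F 0 c = 0) ->
    \sum_(c <- finsupp alpha) F (alpha c) c = \sum_(c <- s) F (f c) c.
  move=> F0; rewrite (big_fset_incl _ (finsupp_sub _ _ _)); last first.
    by move=> c _; rewrite mem_finsupp negbK => /eqP->.
  rewrite (perm_big s); last first.
    by apply: uniq_perm (fset_uniq _) uniq_s _ => c; rewrite seq_fsetE.
  rewrite big_seq [RHS]big_seq; apply: eq_bigr => c cs.
  by rewrite fsfunE seq_fsetE cs.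
have ualpha : hall_expansion B u alpha.
  split=> [c ca|].
    by apply: sB; move: (fsubsetP (finsupp_sub _ _ _) c ca); rewrite seq_fsetE.
  by rewrite us -(sum_alpha _ (fun a c => a *: ev K c)) // => c; rewrite scale0r.
rewrite /hall_norm; case: pselect => [p|[]].
  have -> : sval (cid p) = alpha.
    by apply: hall_expansion_uniq ualpha; case: (svalP (cid p)).
  by rewrite lee_fin (sum_alpha _ (fun a _ => `|a|)) // => c; rewrite normr0.
by exists alpha; split=> // beta; apply: hall_expansion_uniq ualpha.
Qed.

End HallNorm.

(** * Transport to a two-element set and passage from signed sums to expansions *)

Fixpoint br_map (X Y : Type) (h : X -> Y) (t : br X) : br Y :=
  match t with
  | Leaf x => Leaf (h x)
  | Node a b => Node (br_map h a) (br_map h b)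
  end.

Lemma br_mapK (X Y : Type) (h : X -> Y) (h' : Y -> X) :
  cancel h h' -> cancel (br_map h) (br_map h').
Proof. by move=> hK; elim=> [x|a IHa b IHb] /=; rewrite ?hK ?IHa ?IHb. Qed.

Lemma lex_hall_set (X : Type) (h : X -> bool) (h' : bool -> X) : cancel h h' ->
  hall_set [set t : br X | hall (br_map h t)]
           (fun a b => (br_map h a < br_map h b)%O).
Proof.
move=> hK; split.
- by move=> a _; rewrite ltxx.
- by move=> a b c _ _ _; apply: lt_trans.
- move=> a b _ _; case: (ltgtP (br_map h a) (br_map h b)) => [||/(can_inj (br_mapK hK))].
  + by constructor 1.
  + by constructor 3.
  + by constructor 2.
- by [].
- move=> a b /=; split.
    case/and4P => ha hb ab lba; split=> //; case: b lba {hb ab} => [x|l r] /= lba.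
      by left; exists x.
    right; exists l, r; split=> //; move: lba; rewrite le_eqVlt.
    by case/orP => [/eqP/(can_inj (br_mapK hK))|]; [left|right].
  case=> ha hb ab lba; apply/and4P; split=> //.
  by case: lba => [[x ->]//|[l [r [-> /= []]]]] => [->|/ltW].
- by move=> a b _ _; apply: lt_left.
Qed.

Section SeqOfComb.
Local Open Scope ring_scope.
Variables (K : numFieldType) (X : choiceType) (h : bool -> X).

Lemma eval_br_map t : eval_br (fun y => lie_gen K (h y)) t = ev K (br_map h t).
Proof. by elim: t => //= a -> b ->. Qed.

(** Repeated trees are collected into one coefficient; by the triangle inequality the sum of
    absolute values stays at most the count. *)
Lemma comb_seq P n u : comb (fun y => lie_gen K (h y)) P n u ->
  exists (s : seq (br X)) (f : br X -> K),
    [/\ uniq s, forall c, c \in s -> exists2 t, P t & c = br_map h t,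
        u = \sum_(c <- s) f c *: ev K c & \sum_(c <- s) `|f c| <= n%:R].
Proof.
elim=> [|{}n {}u _ [s [f [us sP uE le_n]]]|e {}n t {}u Pt _ [s [f [us sP uE le_n]]]].
- by exists [::], (fun _ => 0); split; rewrite ?big_nil.
- by exists s, f; split=> //; apply: le_trans le_n _; rewrite ler_nat.
pose c := br_map h t; rewrite eval_br_map -/c.
have [cs|cs] := boolP (c \in s).
  exists s, (fun d => f d + (if d == c then (-1) ^+ e else 0)); split=> //.
    under eq_bigr do rewrite scalerDl; rewrite big_split /= -uE addrC.
    rewrite (bigD1_seq c) //= eqxx big1 ?addr0 // => d /negbTE->.
    by rewrite scale0r.
  apply: le_trans (ler_sum _ (fun d _ => ler_normD _ _)) _.
  rewrite big_split /= -natr1 lerD // (bigD1_seq c) //= eqxx big1 ?addr0.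
    by rewrite normr_sign.
  by move=> d /negbTE->; rewrite normr0.
have eq_s d : d \in s -> (d == c) = false.
  by move=> ds; apply: contraNF cs => /eqP<-.
exists (c :: s), (fun d => if d == c then (-1) ^+ e else f d); split.
- by rewrite /= cs.
- by move=> d; rewrite inE => /orP[/eqP->|/sP//]; exists t.
- rewrite big_cons eqxx uE; congr (_ + _); apply: eq_big_seq => d /eq_s->.
  by [].
- rewrite big_cons eqxx normr_sign -nat1r lerD2l; apply: le_trans le_n.
  by rewrite le_eqVlt; apply/orP; left; apply/eqP; apply: eq_big_seq => d /eq_s->.
Qed.

End SeqOfComb.

Theorem theorem1p7 (R : realType) (K : numFieldType) (hK : real_or_complex R K)
    (X : finType) (hX : #|X| = 2%N) :
  exists (B : set (br X)) (lt : br X -> br X -> Prop),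
    hall_set B lt /\
    forall a b : br X, B a -> B b -> lt a b ->
      (3 <= br_size a + br_size b)%N ->
      (hall_norm B (lie (ev K a) (ev K b))
         <= ((fib (br_size a + br_size b - 2))%:R)%:E)%E.
Proof.
(* The enumeration identifies [X] with the booleans; its last element plays the role of [x1]. *)
pose h x := cast_ord hX (enum_rank x) == ord_max.
pose h' y := enum_val (cast_ord (esym hX) (if y then ord_max else ord0)).
have hh' : cancel h h'.
  move=> x; rewrite /h /h'; case: eqP => [<-|rank_x].
    by rewrite cast_ordK enum_rankK.
  have <- : cast_ord hX (enum_rank x) = ord0; last by rewrite cast_ordK enum_rankK.
  by case: (cast_ord _ _) rank_x => -[|[|m]] // lt_m ne; [|case: ne]; apply: val_inj.
have h'h : cancel h' h by case; rewrite /h /h' enum_valK cast_ordKV.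
exists [set t : br X | hall (br_map h t)]%classic, (fun a b => (br_map h a < br_map h b)%O).
have hallB := lex_hall_set hh'; split=> // a b /= ha hb ab size_ab.
have size_map t : br_size (br_map h t) = br_size t.
  by elim: t => //= l -> r ->.
have := @comb_fib K _ (fun y => lie_gen K (h' y)) _ _ ha hb ab.
rewrite !size_map !eval_br_map !(br_mapK hh').
case/(_ size_ab)/comb_seq => s [f [us sP uE le_n]].
apply: (hall_norm_le hallB us _ uE le_n) => c /sP[t ht ->] /=.
by rewrite (br_mapK h'h).
Qed.
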